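(* Let $\Omega$ be a solvable sesquilinear form on $\mathcal{D}$ with respect to an inner product and with associated operator $T$. Let $$\Omega(\xi,\eta)=\langle QH\xi,H\eta\rangle,\qquad\forall\,\xi,\eta\in\mathcal{D},$$ be a Radon-Nikodym-like representation of $\Omega$. Suppose, moreover, that $\Upsilon\in\mathfrak{P}(\Omega)$, that $B\in\mathcal{B}(\mathcal{H})$ is the operator associated to $\Upsilon$ (that is, $\Upsilon(\xi,\eta)=\langle B\xi,\eta\rangle$ for all $\xi,\eta\in\mathcal{H}$), and put $Q_B:=Q+H^{-1}BH^{-1}$. If one of the following statements holds, then $\Omega$ is hyper-solvable. 1. $Q_B\mathcal{D}=\mathcal{D}$; 2. $Q_B$ is positive; 3. $T+B$ is semibounded.
   Context: $\mathcal{H}$ is a complex Hilbert space with inner product $\langle\cdot,\cdot\rangle$ (linear in the first variable) and norm $\|\cdot\|$; $\mathcal{D}$ is a dense subspace of $\mathcal{H}$; sesquilinear forms are linear in the first and conjugate-linear in the second variable. $\mathcal{B}(\mathcal{H})$ is the set of bounded everywhere defined operators on $\mathcal{H}$ and $\rho(A)$ denotes the resolvent set of $A$. A sesquilinear form $\Omega$ on $\mathcal{D}$ is q-closed with respect to a norm $\|\cdot\|_\Omega$ on $\mathcal{D}$ if: (i) there is $\alpha>0$ with $\|\xi\|\le\alpha\|\xi\|_\Omega$ for all $\xi\in\mathcal{D}$; (ii) $\mathcal{E}_\Omega:=(\mathcal{D},\|\cdot\|_\Omega)$ is a reflexive Banach space; (iii) there is $\beta>0$ with $|\Omega(\xi,\eta)|\le\beta\|\xi\|_\Omega\|\eta\|_\Omega$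 for all $\xi,\eta\in\mathcal{D}$. Let $\mathcal{E}_\Omega^\times$ be the space of bounded conjugate linear functionals on $\mathcal{E}_\Omega$. $\mathfrak{P}(\Omega)$ is the set of bounded sesquilinear forms $\Upsilon$ on $\mathcal{H}$ such that: (1) if $\xi\in\mathcal{D}$ and $(\Omega+\Upsilon)(\xi,\eta)=0$ for all $\eta\in\mathcal{D}$ then $\xi=0$; (2) for every $\Lambda\in\mathcal{E}_\Omega^\times$ there is $\xi\in\mathcal{D}$ with $\Lambda(\eta)=(\Omega+\Upsilon)(\xi,\eta)$ for all $\eta\in\mathcal{D}$. $\Omega$ is solvable (with respect to $\|\cdot\|_\Omega$) if it is q-closed and $\mathfrak{P}(\Omega)\neq\emptyset$; it is q-closed (solvable) with respect to an inner product if $\|\cdot\|_\Omega$ is a Hilbert norm. All norms with respect to which $\Omega$ is q-closed are known to be equivalent. The operator $T$ associated to a solvable form $\Omega$ is given by: $\xi\in D(T)$ and $T\xi=\chi$ if and only if $\xi\in\mathcal{D}$, $\chi\in\mathcal{H}$ and $\Omega(\xi,\eta)=\langle\chi,\eta\rangle$ for all $\eta\in\mathcal{D}$. It is known that $T$ is closed and densely defined. $\Omega$ is hyper-solvable if $\mathcal{D}=D(|T|^{1/2})$, where $|T|=(T^*T)^{1/2}$. A Radon-Nikodym-like representation of $\Omega$ is an expression $\Omega(\xi,\eta)=\langle QH\xi,H\eta\rangle$ for all $\xi,\eta\in\mathcal{D}$, where $Q\in\mathcal{B}(\mathcal{H})$ and $H$ is a positive self-adjoint operator with $D(H)=\mathcal{D}$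 and $0\in\rho(H)$. An operator $A$ is positive if $\langle A\xi,\xi\rangle\ge 0$ for all $\xi\in D(A)$, and semibounded if there is $\gamma\in\mathbb{R}$ with $\langle A\xi,\xi\rangle\ge\gamma\|\xi\|^2$ for all $\xi\in D(A)$. *)

(* Defs.v *)
From mathcomp Require Import all_boot all_order all_algebra.
From mathcomp Require Import complex.
From mathcomp Require Import all_classical all_reals all_analysis.

Set Implicit Arguments.
Unset Strict Implicit.
Unset Printing Implicit Defensive.

Import Order.TTheory GRing.Theory Num.Theory.
Import numFieldNormedType.Exports.

Local Open Scope classical_set_scope.
Local Open Scope ring_scope.

(* A complex Hilbert space is a complete normed space V over R[i], together
   with a form ip : {dot V for Num.conj} that induces the norm of V.  Such a
   form is linear in its first argument and conjugate-linear in its second.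
   On R[i], z <= w means that w - z is a nonnegative real number, so
   "0 <= z" and "0 < z" assert in particular that z is real. *)
Definition hilbert_inner_product (R : realType)
    (V : completeNormedModType R[i]) (ip : {dot V for Num.conj}) : Prop :=
  forall x : V, ip x x = `|x| ^+ 2.

Definition linear_subspace (K : pzRingType) (U : lmodType K) (X : set U) : Prop :=
  X 0 /\ forall (a : K) (x y : U), X x -> X y -> X (a *: x + y).

(* Forms, norms and functionals on a subspace D are total functions on V of
   which only the values on D matter. *)
Section Forms.
Context {R : realType} {V : completeNormedModType R[i]}.
Local Notation C := R[i].
Implicit Types (D : set V) (N : V -> C) (Omega Upsilon : V -> V -> C).

Definition sesquilinear_on D Omega : Prop :=
  (forall (a : C) x y z, D x -> D y -> D z ->
     Omega (a *: x + y) z = a * Omega x z + Omega y z) /\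
  (forall (a : C) x y z, D x -> D y -> D z ->
     Omega x (a *: y + z) = a^* * Omega x y + Omega x z).

Definition norm_on D N : Prop :=
  [/\ forall x, D x -> 0 <= N x,
      forall x, D x -> N x = 0 -> x = 0,
      forall (a : C) x, D x -> N (a *: x) = `|a| * N x
    & forall x y, D x -> D y -> N (x + y) <= N x + N y].

Definition inner_product_on D (g : V -> V -> C) : Prop :=
  [/\ sesquilinear_on D g,
      forall x y, D x -> D y -> g y x = (g x y)^*
    & forall x, D x -> x != 0 -> 0 < g x x].

Definition hilbert_norm D N : Prop :=
  exists2 g, inner_product_on D g & forall x, D x -> N x ^+ 2 = g x x.

Definition complete_on D N : Prop :=
  forall u : nat -> V, (forall n, D (u n)) ->
    (forall e : C, 0 < e -> exists n0 : nat, forall m n : nat,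
       (n0 <= m)%N -> (n0 <= n)%N -> N (u m - u n) < e) ->
  exists2 l, D l & forall e : C, 0 < e -> exists n0 : nat, forall n : nat,
    (n0 <= n)%N -> N (u n - l) < e.

Definition linear_functional_on D (L : V -> C) : Prop :=
  forall (a : C) x y, D x -> D y -> L (a *: x + y) = a * L x + L y.

Definition conj_linear_functional_on D (L : V -> C) : Prop :=
  forall (a : C) x y, D x -> D y -> L (a *: x + y) = a^* * L x + L y.

Definition functional_bound D N (L : V -> C) (M : C) : Prop :=
  0 <= M /\ forall x, D x -> `|L x| <= M * N x.

Definition dual D N : set (V -> C) :=
  [set L | linear_functional_on D L /\ exists M, functional_bound D N L M].

Definition conj_dual D N : set (V -> C) :=
  [set L | conj_linear_functional_on D L /\
           exists M, functional_bound D N L M].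

(* The dual norm of L is the least M with functional_bound D N L M, so the
   last clause reads |F L| <= c * ||L||.  With additivity it implies that F L
   depends only on the restriction of L to D. *)
Definition bidual D N : set ((V -> C) -> C) :=
  [set F | (forall (a : C) L L', dual D N L -> dual D N L' ->
              F (fun x => a * L x + L' x) = a * F L + F L') /\
           exists c : C, forall L M, dual D N L ->
              functional_bound D N L M -> `|F L| <= c * M].

Definition reflexive_on D N : Prop :=
  forall F, bidual D N F -> exists2 x, D x & forall L, dual D N L -> F L = L x.

Definition q_closed D Omega N : Prop :=
  norm_on D N /\
  [/\ exists2 alpha : C, 0 < alpha & forall x, D x -> `|x| <= alpha * N x,
      complete_on D N,
      reflexive_on D N
    & exists2 beta : C, 0 < beta &
        forall x y, D x -> D y -> `|Omega x y| <= beta * N x * N y].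

Definition bounded_form Upsilon : Prop :=
  sesquilinear_on setT Upsilon /\
  exists M : C, forall x y, `|Upsilon x y| <= M * `|x| * `|y|.

(* The set P(Omega), for Omega q-closed with respect to N *)
Definition perturbations D Omega N : set (V -> V -> C) :=
  [set Upsilon | [/\ bounded_form Upsilon,
     forall x, D x ->
       (forall y, D y -> Omega x y + Upsilon x y = 0) -> x = 0
   & forall L, conj_dual D N L ->
       exists2 x, D x & forall y, D y -> L y = Omega x y + Upsilon x y]].

Definition solvable D Omega N : Prop :=
  q_closed D Omega N /\ perturbations D Omega N !=set0.

End Forms.

(* Unbounded operators in V are represented by their graphs. *)
Section Operators.
Context {R : realType} {V : completeNormedModType R[i]}.
Local Notation C := R[i].
Implicit Types (A B S : set (V * V)) (X : set V).

Definition is_operator A : Prop :=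
  linear_subspace A /\ forall x y y', A (x, y) -> A (x, y') -> y = y'.

Definition op_dom A : set V := [set x | exists y, A (x, y)].

Definition op_image A X : set V := [set y | exists2 x, X x & A (x, y)].

Definition op_graph (f : V -> V) : set (V * V) := [set p | p.2 = f p.1].

Definition op_add A B : set (V * V) :=
  [set p | exists y z, [/\ A (p.1, y), B (p.1, z) & p.2 = y + z]].

Definition op_comp A B : set (V * V) :=
  [set p | exists2 y, B (p.1, y) & A (y, p.2)].

Definition op_inv A : set (V * V) := [set p | A (p.2, p.1)].

(* The graph of A - l *)
Definition op_shift A (l : C) : set (V * V) :=
  [set p | A (p.1, p.2 + l *: p.1)].

Definition bounded_op (f : {linear V -> V}) : Prop :=
  exists M : C, forall x, `|f x| <= M * `|x|.

Definition resolvent_set A : set C :=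
  [set l | exists2 S : {linear V -> V}, bounded_op S &
             op_inv (op_shift A l) = op_graph S].

Variable ip : {dot V for Num.conj}.

Definition op_adjoint A : set (V * V) :=
  [set p | forall x y, A (x, y) -> ip y p.1 = ip x p.2].

Definition self_adjoint A : Prop :=
  [/\ is_operator A, dense (op_dom A) & op_adjoint A = A].

Definition op_positive A : Prop := forall x y, A (x, y) -> 0 <= ip y x.

Definition op_semibounded A : Prop :=
  exists gamma : R, forall x y, A (x, y) ->
    real_complex R gamma * `|x| ^+ 2 <= ip y x.

(* The positive self-adjoint square root, which is unique when it exists; the
   junk value set0 is not the graph of an operator (its domain omits 0). *)
Definition op_sqrt A : set (V * V) :=
  xget set0 [set S | [/\ self_adjoint S, op_positive S & op_comp S S = A]].

Definition op_abs A : set (V * V) := op_sqrt (op_comp (op_adjoint A) A).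

Definition form_operator (D : set V) (Omega : V -> V -> C) : set (V * V) :=
  [set p | D p.1 /\ forall y, D y -> Omega p.1 y = ip p.2 y].

Definition hyper_solvable (D : set V) (Omega : V -> V -> C) : Prop :=
  (exists N, solvable D Omega N) /\
  D = op_dom (op_sqrt (op_abs (form_operator D Omega))).

Definition radon_nikodym_like (D : set V) (Omega : V -> V -> C)
    (Q : {linear V -> V}) (H : set (V * V)) : Prop :=
  [/\ bounded_op Q,
      self_adjoint H /\ op_positive H,
      op_dom H = D /\ resolvent_set H 0
    & forall x y hx hy, H (x, hx) -> H (y, hy) -> Omega x y = ip (Q hx) hy].

(* Q + H^-1 B H^-1 *)
Definition op_QB (Q B : {linear V -> V}) (H : set (V * V)) : set (V * V) :=
  op_add (op_graph Q)
    (op_comp (op_inv H) (op_comp (op_graph B) (op_inv H))).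

End Operators.

(* Main.v *)
(* With J = H^-1 and F = Q_B = Q + J B J, the operators are
   T = {(J u, y) : Q u = J y} and T + B = {(J u, y) : F u = J y}, and the perturbation
   hypothesis makes F bijective with bounded inverse.  In case 1 let M = 1; in cases 2
   and 3 the form of F is bounded below by gamma |J u|^2 and, F being bounded below
   in norm, M = F + c J^2 is coercive for c large.  Then K = H M H is a positive
   symmetric operator onto the space, with D(K) = D(T) and with equivalent graph
   norms, and <K J u, J u> is comparable to |u|^2.  A theorem of Krein turns the
   comparability of the norms |K x| and | |T| x | + |x| into that of the forms
   <K x, x> and < |T| x, x> + |x|^2, so that H and |T|^(1/2) have equivalent graph
   norms on the common core D(T), hence the same domain.  Only the real part of the
   inner product is used, because a complex linear relation has the same adjoint
   for it and, when symmetric, the same positivity. *)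
Require Import Defs.
From mathcomp Require Import all_boot all_order all_algebra.
From mathcomp Require Import complex.
From mathcomp Require Import all_classical all_reals all_analysis.
From mathcomp Require Import ring lra.
Import Order.TTheory GRing.Theory Num.Theory.
Import numFieldNormedType.Exports.
Local Open Scope classical_set_scope.
Local Open Scope ring_scope.

Set Implicit Arguments.
Unset Strict Implicit.
Unset Printing Implicit Defensive.

(** [T] need not be symmetric, so its form says nothing direct about |T|; what passes from [T] to
    |T| is the identity | |T| x | = |T x|. Inequalities between norms must therefore become
    inequalities between forms, and Krein's theorem does this when the dominating operator is
    positive and onto: hence |T| + 1 in place of |T|, and a coercive M. In case 1, [F] maps the
    range of [J] onto itself, so D(T) = J F^-1 J V = J J V is the domain of H^2, which explains M =
    1. In the other two cases K is T + B + c. Surjectivity of [F] uses the norm N: the functional x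
    -> <v, H x> on D has to be N-bounded, and |H x| <= c N x comes from a closed graph argument. *)

(** * Semi-inner products and the Riesz argument *)

Lemma quadratic_ge0_discr {R : realType} (e b a : R) : 0 <= a ->
  (forall t, 0 <= e + 2 * t * b + t ^+ 2 * a) -> b ^+ 2 <= e * a.
Proof.
rewrite le_eqVlt => /orP[/eqP <-|a0] h.
- rewrite mulr0; have [->|b0] := eqVneq b 0; first by rewrite expr0n.
  (* For [a = 0] the polynomial is affine in t, and this t gives it the value -1. *)
  have := h (- (e + 1) / (2 * b)).
  suff -> : e + 2 * (- (e + 1) / (2 * b)) * b
     + (- (e + 1) / (2 * b)) ^+ 2 * 0 = -1 by lra.
  by field.
- have := h (- b / a).
  have -> : e + 2 * (- b / a) * b + (- b / a) ^+ 2 * a = e - b ^+ 2 / a.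
    by field; lra.
  by rewrite subr_ge0 ler_pdivrMr.
Qed.

Lemma cvg_seq_unique {R : realType} (u : nat -> R) (a b : R) :
  u @ \oo --> a -> u @ \oo --> b -> a = b.
Proof. by move=> ha hb; apply: (cvg_unique _ ha hb); exact: norm_hausdorff. Qed.

(** Degenerate forms are allowed: besides the real inner product, instances are the graph inner
    product, <M u, w> for positive M, and <p.1 + p.2, q.1 + q.2> on pairs. *)
Record semi_inner {R : realType} {W : lmodType R[i]} (g : W -> W -> R) : Prop :=
  SemiInner {
    siDl : forall x y z, g (x + y) z = g x z + g y z;
    siC : forall x y, g x y = g y x;
    siZ : forall (a : R) x y, g (real_complex R a *: x) y = a * g x y;
    si_ge0 : forall x, 0 <= g x x }.

Definition sinorm {R : realType} {W : lmodType R[i]} (g : W -> W -> R) (x : W) :=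
  Num.sqrt (g x x).

Section SemiInnerTheory.
Context {R : realType} {W : lmodType R[i]} {g : W -> W -> R}.
Hypothesis hg : semi_inner g.
Local Notation nm := (sinorm g).

Lemma siDr x y z : g x (y + z) = g x y + g x z.
Proof. by rewrite siC // siDl // !(siC hg _ x). Qed.
Lemma siZr (a : R) x y : g x (real_complex R a *: y) = a * g x y.
Proof. by rewrite siC // siZ // (siC hg _ x). Qed.
Lemma siNl x y : g (- x) y = - g x y.
Proof.
have -> : - x = real_complex R (-1) *: x by rewrite rmorphN1 scaleN1r.
by rewrite siZ // mulN1r.
Qed.
Lemma siNr x y : g x (- y) = - g x y.
Proof. by rewrite siC // siNl // (siC hg x). Qed.
Lemma siBl x y z : g (x - y) z = g x z - g y z.
Proof. by rewrite siDl // siNl. Qed.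
Lemma siBr x y z : g x (y - z) = g x y - g x z.
Proof. by rewrite siDr // siNr. Qed.
Lemma si0l y : g 0 y = 0.
Proof. by rewrite -(subrr 0) siBl subrr. Qed.
Lemma si0r y : g y 0 = 0.
Proof. by rewrite siC // si0l. Qed.
Definition siE := (siDl hg, siDr, siBl, siBr, siNl, siNr, siZ hg, siZr).

Lemma si_CS x y : g x y ^+ 2 <= g x x * g y y.
Proof.
apply: quadratic_ge0_discr; first exact: si_ge0.
move=> t; have := si_ge0 hg (x + real_complex R t *: y).
by rewrite !siE (siC hg y x); lra.
Qed.

Lemma sinorm_ge0 x : 0 <= nm x. Proof. exact: sqrtr_ge0. Qed.
Lemma sinormE x : nm x ^+ 2 = g x x.
Proof. by rewrite sqr_sqrtr // si_ge0. Qed.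
Lemma sinorm_sqrle x c : 0 <= c -> (nm x <= c) = (g x x <= c ^+ 2).
Proof. by move=> c0; rewrite -sinormE ler_sqr// nnegrE// sinorm_ge0. Qed.

Lemma si_le x y : `|g x y| <= nm x * nm y.
Proof.
rewrite -sqrtrM ?si_ge0// -sqrtr_sqr ler_sqrt ?si_CS//.
by rewrite mulr_ge0 ?si_ge0.
Qed.
Lemma si_ler x y : g x y <= nm x * nm y.
Proof. exact: le_trans (ler_norm _) (si_le _ _). Qed.

Lemma sinormD x y : nm (x + y) <= nm x + nm y.
Proof.
rewrite sinorm_sqrle ?addr_ge0 ?sinorm_ge0// !siE (siC hg y x).
rewrite sqrrD !sinormE; have := si_ler x y; lra.
Qed.
Lemma sinormN x : nm (- x) = nm x.
Proof. by rewrite /sinorm !siE opprK. Qed.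
Lemma sinormB x y : nm (x - y) <= nm x + nm y.
Proof. by rewrite -(sinormN y) sinormD. Qed.
Lemma sinormC x y : nm (x - y) = nm (y - x).
Proof. by rewrite -sinormN opprB. Qed.
Lemma sinorm_triB x y : nm x <= nm (x - y) + nm y.
Proof. by rewrite -{1}(subrK y x) sinormD. Qed.
Lemma sinorm0 : nm 0 = 0.
Proof. by rewrite /sinorm si0l sqrtr0. Qed.
Lemma sinormZ (a : R) x : nm (real_complex R a *: x) = `|a| * nm x.
Proof.
by rewrite /sinorm !siE mulrA -expr2 sqrtrM ?sqr_ge0// sqrtr_sqr.
Qed.

End SemiInnerTheory.

Definition cauchy_for {R : realType} {W : zmodType} (p : W -> R) (u : nat -> W) :=
  forall e : R, 0 < e -> exists n0 : nat, forall m n : nat,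
    (n0 <= m)%N -> (n0 <= n)%N -> p (u m - u n) < e.

Definition tends {R : realType} {W : zmodType} (p : W -> R) (u : nat -> W) l :=
  (fun n => p (u n - l)) @ \oo --> (0 : R).

Lemma tendsP {R : realType} {W : zmodType} (p : W -> R) (u : nat -> W) l :
  (forall x, 0 <= p x) ->
  tends p u l <-> forall e : R, 0 < e -> exists n0 : nat, forall n : nat,
    (n0 <= n)%N -> p (u n - l) < e.
Proof.
move=> p0; split.
- move=> /cvgr0Pnorm_lt h e e0; have [n0 _ hn] := h e e0.
  by exists n0 => n /hn /=; rewrite ger0_norm.
- move=> h; apply/cvgr0Pnorm_lt => e e0; have [n0 hn] := h e e0.
  by exists n0 => // n /= /hn; rewrite ger0_norm.
Qed.

(* A minimizing sequence of [g x x - 2 * L x] converges weakly to the vector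
   representing [L]; completeness is not needed to get a Cauchy sequence. *)
Lemma riesz_sequence {R : realType} {W : lmodType R[i]} (g : W -> W -> R)
    (D : set W) (L : W -> R) (M : R) :
  semi_inner g -> linear_subspace D ->
  (forall x y, D x -> D y -> L (x + y) = L x + L y) ->
  (forall (a : R) x, D x -> L (real_complex R a *: x) = a * L x) ->
  (forall x, D x -> L x <= M * sinorm g x) ->
  exists u : nat -> W, [/\ forall n, D (u n), cauchy_for (sinorm g) u &
    forall y, D y -> (fun n => g y (u n)) @ \oo --> L y].
Proof.
move=> hg [D0 DP] LD LZ LM.
have DD x y : D x -> D y -> D (x + y).
  by move=> Dx Dy; rewrite -(scale1r x); apply: DP.
have DZ a x : D x -> D (a *: x).
  by move=> Dx; rewrite -(addr0 (a *: x)); apply: DP.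
pose J (x : W) : R := g x x - 2 * L x.
pose A : set R := [set J x | x in D].
have hA : has_inf A.
  split; first by exists (J 0); exists 0.
  (* With s = |x|, J x >= s^2 - 2 M s >= - M^2. *)
  exists (- M ^+ 2) => _ [x Dx <-]; rewrite /J -(sinormE hg x).
  have := LM x Dx; have := sqr_ge0 (sinorm g x - M); nra.
have Age x : D x -> inf A <= J x by move=> Dx; apply: (ge_inf hA.2); exists x.
have hu n : {x | D x /\ J x < inf A + (n.+1%:R)^-1}.
  apply: cid; have e0 : 0 < (n.+1%:R)^-1 :> R by rewrite invr_gt0.
  by have [_ [x Dx <-] h] := inf_adherent e0 hA; exists x.
pose u n := sval (hu n).
have Du n : D (u n) by rewrite /u; case: (hu n) => x /= [].
have Ju n : J (u n) < inf A + (n.+1%:R)^-1 by rewrite /u; case: (hu n) => x /= [].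
exists u; split => //.
- move=> e e0.
  have e20 : 0 < e ^+ 2 / 4 by rewrite divr_gt0 ?exprn_gt0.
  have [n0 _ hn0] := near_infty_natSinv_lt (PosNum e20).
  exists n0 => m n /hn0 /= hm /hn0 /= hn.
  have [Jm Jn] := (Ju m, Ju n).
  (* Parallelogram law: |u m - u n|^2 = 2 J (u m) + 2 J (u n) - 4 J (midpoint), and the midpoint
     value is at least [inf A]. *)
  have Dmid : D (real_complex R (1/2) *: (u m + u n)) by apply: DZ; apply: DD.
  have := Age _ Dmid; rewrite /J LZ ?LD//; last exact: DD.
  rewrite /sinorm -(ltr_pXn2r (n := 2)) ?nnegrE ?sqrtr_ge0 ?(ltW e0)//.
  rewrite sqr_sqrtr ?si_ge0// !(siE hg) (siC hg (u n) (u m)).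
  move: hm hn Jm Jn; rewrite /J; move: (m.+1%:R^-1) (n.+1%:R^-1) => a b; lra.
- move=> y Dy.
  (* Discriminant of t -> J (u n + t y) - [inf A], which is nonnegative and less than 1/(n+1) at t =
     0. *)
  have key n : (g y (u n) - L y) ^+ 2 <= (n.+1%:R)^-1 * g y y.
    apply: quadratic_ge0_discr; first exact: si_ge0.
    move=> t; have := Age _ (DD _ _ (Du n) (DZ (real_complex R t) _ Dy)).
    rewrite /J !(siE hg) LD ?LZ//; last exact: DZ.
    have := Ju n; rewrite /J (siC hg (u n) y); move: (n.+1%:R^-1) => a; lra.
  apply/cvgrPdist_lt => e e0.
  have e20 : 0 < e ^+ 2 / (g y y + 1).
    by rewrite divr_gt0 ?exprn_gt0// ltr_wpDl// si_ge0.
  have [n0 _ hn0] := near_infty_natSinv_lt (PosNum e20).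
  exists n0 => // n /hn0 /=; rewrite ltr_pdivlMr ?ltr_wpDl ?si_ge0// => hn.
  rewrite distrC -(ltr_pXn2r (n := 2)) ?nnegrE ?(ltW e0)// real_normK ?num_real//.
  have := key n; have : 0 < (n.+1%:R)^-1 :> R by rewrite invr_gt0.
  move: hn; move: (n.+1%:R^-1) => a; nra.
Qed.

(** * Linear maps and subspaces *)

Definition islin {K : pzRingType} {U W : lmodType K} (f : U -> W) :=
  forall a x y, f (a *: x + y) = a *: f x + f y.

Section IsLin.
Context {K : pzRingType} {U W : lmodType K} {f : U -> W}.
Hypothesis hf : islin f.
Lemma linD x y : f (x + y) = f x + f y.
Proof. by have := hf 1 x y; rewrite !scale1r. Qed.
Lemma lin0 : f 0 = 0.
Proof. by apply: (addrI (f 0)); rewrite -linD !addr0. Qed.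
Lemma linZ a x : f (a *: x) = a *: f x.
Proof. by have := hf a x 0; rewrite lin0 !addr0. Qed.
Lemma linN x : f (- x) = - f x.
Proof. by rewrite -scaleN1r linZ scaleN1r. Qed.
Lemma linB x y : f (x - y) = f x - f y.
Proof. by rewrite linD linN. Qed.
End IsLin.

Section Subspace.
Context {K : pzRingType} {U : lmodType K} {X : set U}.
Hypothesis hX : linear_subspace X.
Lemma subspaceD x y : X x -> X y -> X (x + y).
Proof. by move=> Xx Xy; rewrite -(scale1r x); apply: hX.2. Qed.
Lemma subspaceZ a x : X x -> X (a *: x).
Proof. by move=> Xx; rewrite -(addr0 (a *: x)); apply: hX.2 => //; exact: hX.1. Qed.
Lemma subspaceN x : X x -> X (- x).
Proof. by move=> Xx; rewrite -scaleN1r; apply: subspaceZ. Qed.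
Lemma subspaceB x y : X x -> X y -> X (x - y).
Proof. by move=> Xx /subspaceN; apply: subspaceD. Qed.
End Subspace.

(* A complex Hilbert space seen through the real part of its inner product. *)
Record real_hilbert {R : realType} {V : lmodType R[i]} (rp : V -> V -> R) : Prop :=
  RealHilbert {
    rh_si : semi_inner rp;
    rh_eq0 : forall x, rp x x = 0 -> x = 0;
    rh_i : forall x y, rp ('i *: x) ('i *: y) = rp x y;
    rh_complete : forall u, cauchy_for (sinorm rp) u ->
      exists l, tends (sinorm rp) u l }.

(** * Norm convergence for the real part of the inner product *)

Section RealHilbertTheory.
Context {R : realType} {V : lmodType R[i]} {rp : V -> V -> R}.
Hypothesis hV : real_hilbert rp.
Local Notation nm := (sinorm rp).
Let hg : semi_inner rp := rh_si hV.
Implicit Types (x y z l : V) (u v : nat -> V) (f : V -> V) (G : set (V * V)).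

Lemma rp_il x y : rp ('i *: x) y = - rp x ('i *: y).
Proof.
rewrite -(rh_i hV x) scalerA -expr2 sqr_i scaleN1r (siNr hg) opprK //.
Qed.

Lemma rpZc (a : R[i]) x y :
  rp (a *: x) y = complex.Re a * rp x y + complex.Im a * rp ('i *: x) y.
Proof.
rewrite {1}(complexE a) scalerDl (siDl hg) (siZ hg); congr (_ + _).
by rewrite mulrC -scalerA (siZ hg).
Qed.

Lemma rp_conj (a : R[i]) x y : rp (a *: x) y = rp x (a^* *: y).
Proof.
rewrite (rpZc a) (siC hg x (a^* *: y)) (rpZc a^*); case: a => a b /=.
by rewrite rp_il (siC hg y) (siC hg ('i *: y)) mulrN mulNr.
Qed.

Lemma rp_eq0 x : (forall y, rp x y = 0) -> x = 0.
Proof. by move=> h; apply: (rh_eq0 hV); apply: h. Qed.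

Lemma nm_eq0 x : nm x = 0 -> x = 0.
Proof. by move=> h; apply: (rh_eq0 hV); rewrite -(sinormE hg) h expr0n. Qed.

Lemma nm_le0 x : nm x <= 0 -> x = 0.
Proof. by move=> h; apply: nm_eq0; apply/eqP; rewrite eq_le h sinorm_ge0. Qed.

Lemma nmZc (a : R[i]) x : nm (a *: x) <= (`|complex.Re a| + `|complex.Im a|) * nm x.
Proof.
rewrite {1}(complexE a) scalerDl mulrDl (le_trans (sinormD hg _ _))// lerD//.
  by rewrite (sinormZ hg).
by rewrite mulrC -scalerA (sinormZ hg) /sinorm (rh_i hV).
Qed.

Lemma tends_squeeze u l (c : nat -> R) :
  (forall n, nm (u n - l) <= c n) -> c @ \oo --> (0 : R) -> tends nm u l.
Proof.
move=> h hc; apply: (squeeze_cvgr _ (cvg_cst 0) hc).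
by near=> n; rewrite sinorm_ge0 h.
Unshelve. all: by end_near. Qed.

Lemma tends_cst x : tends nm (fun=> x) x.
Proof.
apply: (@tends_squeeze _ _ (fun=> 0)) => [n|]; last exact: cvg_cst.
by rewrite subrr (sinorm0 hg).
Qed.

Lemma tendsD u v l m : tends nm u l -> tends nm v m ->
  tends nm (fun n => u n + v n) (l + m).
Proof.
move=> hu hv; apply: (@tends_squeeze _ _ (fun n => nm (u n - l) + nm (v n - m))).
  by move=> n; rewrite opprD addrACA (sinormD hg).
by rewrite -(addr0 (0 : R)); apply: cvgD.
Qed.

Lemma tends_bounded f u l (M : R) : islin f ->
  (forall x, nm (f x) <= M * nm x) -> tends nm u l ->
  tends nm (fun n => f (u n)) (f l).
Proof.
move=> hf hM hu; apply: (@tends_squeeze _ _ (fun n => M * nm (u n - l))).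
  by move=> n; rewrite -(linB hf).
by rewrite -(mulr0 M); apply: cvgMr.
Qed.

Lemma tendsZ (a : R[i]) u l : tends nm u l -> tends nm (fun n => a *: u n) (a *: l).
Proof.
apply: tends_bounded => [b x y|x]; last exact: nmZc.
by rewrite scalerDr !scalerA mulrC.
Qed.

Lemma tendsB u v l m : tends nm u l -> tends nm v m ->
  tends nm (fun n => u n - v n) (l - m).
Proof.
move=> hu /(tendsZ (-1)); rewrite scaleN1r => /(tendsD hu).
by under eq_fun do rewrite scaleN1r.
Qed.

Lemma tends_rp u l y : tends nm u l -> (fun n => rp (u n) y) @ \oo --> rp l y.
Proof.
move=> hu; apply/subr_cvg0; apply/norm_cvg0P.
apply: (squeeze_cvgr _ (cvg_cst 0) (f := fun=> 0) (h := fun n => nm (u n - l) * nm y)).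
  by near=> n; rewrite normr_ge0/= -(siBl hg) (si_le hg).
by rewrite -(mul0r (nm y)); apply: cvgMl.
Unshelve. all: by end_near. Qed.

Lemma tends_rpr u l y : tends nm u l -> (fun n => rp y (u n)) @ \oo --> rp y l.
Proof.
by move/tends_rp => /(_ y); rewrite (siC hg l); under eq_fun do rewrite (siC hg).
Qed.

Lemma tends_nm u l : tends nm u l -> (fun n => nm (u n)) @ \oo --> nm l.
Proof.
move=> hu; apply/subr_cvg0; apply/norm_cvg0P.
apply: (squeeze_cvgr _ (cvg_cst 0) hu).
near=> n; rewrite normr_ge0/= ler_norml.
have := sinorm_triB hg (u n) l; have := sinorm_triB hg l (u n).
rewrite (sinormC hg l); lra.
Unshelve. all: by end_near. Qed.

Lemma tends_uniq u l m : tends nm u l -> tends nm u m -> l = m.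
Proof.
move=> hl hm; apply/eqP; rewrite -subr_eq0; apply/eqP; apply: nm_le0.
have := tendsB hl hm; under eq_fun do rewrite subrr.
move=> /tends_nm; rewrite (sinorm0 hg) => h.
by rewrite -(cvg_seq_unique h (cvg_cst _)).
Qed.

Lemma tends_le u l (c : R) : tends nm u l -> (forall n, nm (u n) <= c) -> nm l <= c.
Proof. by move=> /tends_nm hu h; apply: (cvgr_to_le hu); apply: nearW. Qed.

Lemma tends_cauchy u l : tends nm u l -> cauchy_for nm u.
Proof.
move=> /(tendsP _ _ (sinorm_ge0 (g:=rp))) h e e0.
have e20 : 0 < e / 2 by rewrite divr_gt0.
have [n0 hn] := h _ e20; exists n0 => m n /hn hm /hn hn'.
have -> : u m - u n = (u m - l) - (u n - l) by rewrite opprB addrA subrK.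
rewrite (le_lt_trans (sinormB hg _ _))//; lra.
Qed.

End RealHilbertTheory.

(** * Closed linear relations and their cores *)

Section Graphs.
Context {R : realType} {V : lmodType R[i]} {rp : V -> V -> R}.
Hypothesis hV : real_hilbert rp.
Local Notation nm := (sinorm rp).
Let hg : semi_inner rp := rh_si hV.
Implicit Types (x y z : V) (u : nat -> V * V) (A G P S T : set (V * V)).

Definition graph_inner (p q : V * V) : R := rp p.1 q.1 + rp p.2 q.2.

Lemma graph_inner_semi : semi_inner graph_inner.
Proof.
split=> [[x1 x2] [y1 y2] [z1 z2]|[x1 x2] [y1 y2]|a [x1 x2] [y1 y2]|[x1 x2]];
  rewrite /graph_inner /=.
- by rewrite !(siDl hg) addrACA.
- by rewrite (siC hg x1) (siC hg x2).
- by rewrite !(siZ hg) mulrDr.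
- by rewrite addr_ge0 ?(si_ge0 hg).
Qed.
Let hgr := graph_inner_semi.

Lemma nm_fst (p : V * V) : nm p.1 <= sinorm graph_inner p.
Proof. by rewrite ler_sqrt ?lerDl ?(si_ge0 hgr) ?(si_ge0 hg). Qed.
Lemma nm_snd (p : V * V) : nm p.2 <= sinorm graph_inner p.
Proof. by rewrite ler_sqrt ?lerDr ?(si_ge0 hgr) ?(si_ge0 hg). Qed.

Definition tends_pair u (p : V * V) :=
  tends nm (fun n => (u n).1) p.1 /\ tends nm (fun n => (u n).2) p.2.

Definition closed_rel G :=
  forall u p, (forall n, G (u n)) -> tends_pair u p -> G p.

Lemma cauchy_pair u : cauchy_for nm (fun n => (u n).1) ->
  cauchy_for nm (fun n => (u n).2) -> exists p, tends_pair u p.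
Proof.
by move=> /(rh_complete hV)[x hx] /(rh_complete hV)[y hy]; exists (x, y).
Qed.

Lemma cauchy_graph u : cauchy_for (sinorm graph_inner) u -> exists p, tends_pair u p.
Proof.
move=> h; apply: cauchy_pair => e /h[n0 hn]; exists n0 => m n /hn hm /hm.
  by apply: le_lt_trans; apply: (le_trans _ (nm_fst _)).
by apply: le_lt_trans; apply: (le_trans _ (nm_snd _)).
Qed.

Lemma tends_graph_inner u p q : tends_pair u p ->
  (fun n => graph_inner q (u n)) @ \oo --> graph_inner q p.
Proof. by move=> [h1 h2]; apply: cvgD; apply: (tends_rpr hV). Qed.

(** The Riesz sequence of q -> <q, p> on [G0] converges to the projection of p onto the closure of
    [G0]; the difference lies in [G] and is orthogonal to [G0], hence vanishes. *)
Lemma core_sequence G0 G p : linear_subspace G0 -> linear_subspace G ->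
  closed_rel G -> (forall q, G0 q -> G q) ->
  (forall q, G q -> (forall r, G0 r -> graph_inner r q = 0) -> q = 0) ->
  G p -> exists2 u, forall n, G0 (u n) & tends_pair u p.
Proof.
move=> hG0 hG cG sub orth Gp.
have [|a x _||u [Gu /cauchy_graph[q uq] hu]] :=
  riesz_sequence (L := fun q => graph_inner q p) (M := sinorm graph_inner p) hgr hG0.
- by move=> x y _ _; rewrite (siDl hgr).
- by rewrite (siZ hgr).
- by move=> x _; rewrite mulrC; exact: (si_ler hgr).
exists u => //; suff -> : p = q by [].
apply/eqP; rewrite -subr_eq0; apply/eqP; apply: orth.
  apply: (subspaceB hG) => //; apply: cG uq => n; exact/sub/Gu.
move=> r Gr; have E := cvg_seq_unique (hu r Gr) (tends_graph_inner uq).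
by rewrite (siBr hgr) -E subrr.
Qed.

Definition operator_on G := forall y, G (0, y) -> y = 0.

(** An estimate on a core extends to the whole relation: it makes the [G2]-images of a
    graph-convergent sequence Cauchy, [G2] is closed, and norms pass to the limit. *)
Lemma core_transfer G0 G1 G2 (C : R) x y :
  linear_subspace G0 -> linear_subspace G2 -> closed_rel G2 -> operator_on G2 ->
  (forall x y, G0 (x, y) -> exists2 z, G2 (x, z) & nm z <= C * (nm x + nm y)) ->
  (forall p, G1 p -> exists2 u, forall n, G0 (u n) & tends_pair u p) ->
  G1 (x, y) -> exists2 z, G2 (x, z) & nm z <= C * (nm x + nm y).
Proof.
move=> hG0 hG2 cG2 oG2 h core /core[u Gu [/= hu1 hu2]].
have hz n : exists z, G2 ((u n).1, z) /\ nm z <= C * (nm (u n).1 + nm (u n).2).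
  by have [|z] := h (u n).1 (u n).2; [rewrite -surjective_pairing|exists z].
have [z zP] := choice hz.
have zB m n : nm (z m - z n) <= C * (nm ((u m).1 - (u n).1) + nm ((u m).2 - (u n).2)).
  have [|w Gw hw] := h ((u m).1 - (u n).1) ((u m).2 - (u n).2).
    by have := subspaceB hG0 (Gu m) (Gu n).
  suff -> : z m - z n = w by [].
  apply/eqP; rewrite -subr_eq0; apply/eqP; apply: oG2.
  have : G2 ((u m).1 - (u n).1 - ((u m).1 - (u n).1), z m - z n - w).
    exact: (subspaceB hG2 (subspaceB hG2 (zP m).1 (zP n).1) Gw).
  by rewrite subrr.
have C1 : 0 < `|C| + 1 by rewrite ltr_wpDl.
have cz : cauchy_for nm z.
  move=> e e0; have e20 : 0 < e / 2 / (`|C| + 1) by rewrite !divr_gt0.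
  have [n1 h1] := tends_cauchy hV hu1 e20.
  have [n2 h2] := tends_cauchy hV hu2 e20.
  exists (maxn n1 n2) => m n; rewrite !geq_max => /andP[m1 m2] /andP[k1 k2].
  apply: (le_lt_trans (zB m n)).
  have := h1 m n m1 k1; have := h2 m n m2 k2; rewrite !ltr_pdivlMr//.
  have := ler_norm C; have := sinorm_ge0 (g:=rp) ((u m).1 - (u n).1).
  have := sinorm_ge0 (g:=rp) ((u m).2 - (u n).2).
  move: (nm _) (nm _) => a b; nra.
have [w zw] := rh_complete hV cz.
exists w.
  apply: (cG2 (fun n => ((u n).1, z n))); first by move=> n; case: (zP n).
  by split.
apply: (ler_cvg_to (tends_nm hV zw) (f := fun n => nm (z n))); last first.
  by apply: nearW => n; exact: (zP n).2.
by apply: cvgMr; apply: cvgD; apply: (tends_nm hV).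
Qed.

(** This is [core_sequence] for the zero operator restricted to [X], inside the zero operator on the
    whole space. *)
Lemma orth_dense (X : set V) : linear_subspace X ->
  (forall x, (forall y, X y -> rp y x = 0) -> x = 0) ->
  forall x, exists2 u : nat -> V, forall n, X (u n) & tends nm u x.
Proof.
move=> hX orth x.
have [|||_ [y _ <-]|q [y _ <-] h||u Gu [/= hu _]] :=
  @core_sequence [set (y, 0) | y in X] [set (y, 0) | y in setT] (x, 0).
- split; first by exists 0; [exact: hX.1|].
  move=> a _ _ [y Xy <-] [z Xz <-]; exists (a *: y + z); first exact: hX.2.
  by congr pair; rewrite /= scaler0 addr0.
- split; first by exists 0.
  move=> a _ _ [y Xy <-] [z Xz <-]; exists (a *: y + z) => //.
  by congr pair; rewrite /= scaler0 addr0.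
- move=> u [y z] hu [/= h1 h2]; exists y => //; congr pair.
  apply: (tends_uniq hV (tends_cst hV 0)); have <- // : (fun n => (u n).2) = (fun=> 0).
  by apply/funext => n; have [w _ <-] := hu n.
- by exists y.
- rewrite (orth y) // => z Xz; have := h (z, 0); rewrite /graph_inner /= (si0l hg) addr0.
  by apply; exists z.
- by exists x.
- by exists (fun n => (u n).1) => // n; have [y Xy <-] := Gu n.
Qed.

End Graphs.

(** * Square roots of bounded positive operators *)

Section BoundedRoot.
Context {R : realType} {V : lmodType R[i]} {rp : V -> V -> R}.
Hypothesis hV : real_hilbert rp.
Local Notation nm := (sinorm rp).
Let hg : semi_inner rp := rh_si hV.
Implicit Types (x y z : V) (f : V -> V).

Definition symmetric_map f := forall x y, rp (f x) y = rp x (f y).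
Definition bounded_map f := exists M : R, forall x, nm (f x) <= M * nm x.
Definition half : R[i] := real_complex R (1 / 2).

(* Fixed-point iteration for [y = (x + y ^ 2) / 2], whose limit is [1 - sqrt (1 - x)];
   it is used both for [x] the operator [B] and for the real number [x = 1]. *)
Fixpoint root_op (B : V -> V) (n : nat) x : V :=
  if n is n'.+1 then half *: (B x + root_op B n' (root_op B n' x)) else 0.
Fixpoint root_bnd (n : nat) : R :=
  if n is n'.+1 then (1 + root_bnd n' ^+ 2) / 2 else 0.

Lemma root_bnd01 n : 0 <= root_bnd n <= 1.
Proof.
elim: n => [|n /andP[h1 h2]] /=; first by rewrite lexx ler01.
by apply/andP; split; nra.
Qed.
Lemma root_bnd_nd : nondecreasing_seq root_bnd.
Proof.
apply/nondecreasing_seqP => n /=; rewrite ler_pdivlMr//.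
by have := sqr_ge0 (root_bnd n - 1); rewrite sqrrB; lra.
Qed.

Lemma half_double x y : half *: x = y -> x = y + y.
Proof.
move=> <-; rewrite -scalerDl -[LHS]scale1r; congr (_ *: _).
by rewrite /half -rmorphD/=; congr (real_complex R _); lra.
Qed.

Section Iteration.
Variable B : V -> V.
Hypotheses (Blin : islin B) (Bsym : symmetric_map B).
Hypothesis Bcontr : forall x, nm (B x) <= nm x.
Local Notation Y := (root_op B).
Local Notation b := root_bnd.

Lemma root_op_lin n : islin (Y n).
Proof.
elim: n => [|n IH] a x y /=; first by rewrite scaler0 addr0.
by rewrite Blin !IH addrACA -scalerDr (scalerDr half) !scalerA (mulrC a).
Qed.

Lemma root_op_sym n : symmetric_map (Y n).
Proof.
elim: n => [|n IH] x y /=; first by rewrite (si0l hg) (si0r hg).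
by rewrite (siZ hg) (siZr hg) (siDl hg) (siDr hg) Bsym !IH.
Qed.

Lemma nm_half x : nm (half *: x) = nm x / 2.
Proof. by rewrite (sinormZ hg) ger0_norm ?divr_ge0//; lra. Qed.

Lemma root_op_le n x : nm (Y n x) <= b n * nm x.
Proof.
elim: n x => [|n IH] x /=; first by rewrite (sinorm0 hg) mul0r.
rewrite nm_half; have /andP[h1 h2] := root_bnd01 n.
have := sinormD hg (B x) (Y n (Y n x)).
have := Bcontr x; have := IH x; have := IH (Y n x).
move: (nm _) (nm (B x)) (nm _) (nm _) (nm _) => c d e f' g; nra.
Qed.

Lemma root_op_comm n C : islin C -> (forall x, C (B x) = B (C x)) ->
  forall x, C (Y n x) = Y n (C x).
Proof.
move=> Clin CB; elim: n => [|n IH] x /=; first by rewrite (lin0 Clin).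
by rewrite (linZ Clin) (linD Clin) CB !IH.
Qed.

Lemma root_opC m n x : Y m (Y n x) = Y n (Y m x).
Proof.
apply: root_op_comm; first exact: root_op_lin.
by move=> z; rewrite (root_op_comm m Blin).
Qed.

(** The iterates commute, so Y(n+2) - Y(n+1) is half of (Y(n+1) + Y(n)) (Y(n+1) - Y(n)). The scalar
    recursion factors in the same way, so its increments dominate. *)
Lemma root_opS_sub n x : nm (Y n.+1 x - Y n x) <= (b n.+1 - b n) * nm x.
Proof.
elim: n x => [|n IH] x.
  by rewrite subr0 /= subr0; exact: root_op_le 1%N x.
have -> : Y n.+2 x - Y n.+1 x =
    half *: (Y n.+1 (Y n.+1 x - Y n x) + Y n (Y n.+1 x - Y n x)).
  rewrite (linB (root_op_lin n.+1)) (linB (root_op_lin n)) (root_opC n n.+1).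
  transitivity (half *: (B x + Y n.+1 (Y n.+1 x)) - half *: (B x + Y n (Y n x))) => //.
  by rewrite subrKA -scalerBr opprD addrACA subrr add0r.
rewrite nm_half; have := sinormD hg (Y n.+1 (Y n.+1 x - Y n x)) (Y n (Y n.+1 x - Y n x)).
have := root_op_le n.+1 (Y n.+1 x - Y n x); have := root_op_le n (Y n.+1 x - Y n x).
have -> : b n.+2 - b n.+1 = (b n.+1 + b n) * (b n.+1 - b n) / 2 by rewrite /=; lra.
have /andP[b0 _] := root_bnd01 n; have /andP[b1 _] := root_bnd01 n.+1.
have := ler_wpM2l (addr_ge0 b1 b0) (IH x); lra.
Qed.

Lemma root_op_sub m n x : (n <= m)%N -> nm (Y m x - Y n x) <= (b m - b n) * nm x.
Proof.
move=> /subnKC <-; elim: (m - n)%N => [|k IH].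
  by rewrite addn0 !subrr (sinorm0 hg) mul0r.
rewrite addnS -[X in nm X](subrKA (Y (n + k)%N x)) (le_trans (sinormD hg _ _))//.
have := root_opS_sub (n + k) x; lra.
Qed.

Lemma root_bnd_cauchy (e : R) : 0 < e -> exists n0, forall m n,
  (n0 <= n)%N -> (n <= m)%N -> b m - b n < e.
Proof.
move=> e0; have hc : cvgn b.
  apply: nondecreasing_is_cvgn; first exact: root_bnd_nd.
  by exists 1 => _ [n _ <-]; have /andP[] := root_bnd01 n.
have /cvgrPdist_lt/(_ _ e0)[n0 _ hn] := hc.
exists n0 => m n hmn _; have := hn n hmn => /= /(le_lt_trans (ler_norm _)).
have := nondecreasing_cvgn_le root_bnd_nd hc m; lra.
Qed.

Lemma root_op_tends x : exists y, tends nm (Y^~ x) y.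
Proof.
apply: (rh_complete hV) => e e0.
have x1 : 0 < nm x + 1 by rewrite ltr_wpDl// sinorm_ge0.
have [n0 hn0] := root_bnd_cauchy (divr_gt0 e0 x1).
have key m n : (n0 <= n)%N -> (n <= m)%N -> nm (Y m x - Y n x) < e.
  move=> /hn0 h le_nm; have := h m le_nm; rewrite ltr_pdivlMr// => hb.
  apply: le_lt_trans (root_op_sub x le_nm) _; apply: le_lt_trans hb.
  rewrite ler_wpM2l ?lerDl// subr_ge0; exact: (root_bnd_nd le_nm).
exists n0 => m n hm hn; have [|/ltnW] := leqP n m; first exact: key.
by rewrite (sinormC hg); exact: key.
Qed.

Definition root_lim := projT1 (choice root_op_tends).
Lemma root_limP x : tends nm (Y^~ x) (root_lim x).
Proof. by rewrite /root_lim; case: choice. Qed.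

Lemma root_lim_lin : islin root_lim.
Proof.
move=> a x y; apply: (tends_uniq hV (root_limP _)).
have -> : Y^~ (a *: x + y) = (fun n => a *: Y n x + Y n y).
  by apply/funext => n; rewrite root_op_lin.
by apply: (tendsD hV) (root_limP y); apply: (tendsZ hV); exact: root_limP.
Qed.

Lemma root_lim_sym : symmetric_map root_lim.
Proof.
move=> x y; have h := tends_rpr hV (y := x) (root_limP y).
apply: cvg_seq_unique h; under eq_fun do rewrite -root_op_sym.
exact: (tends_rp hV) (root_limP x).
Qed.

Lemma root_lim_le x : nm (root_lim x) <= nm x.
Proof.
apply: (tends_le hV (root_limP x)) => n; apply: le_trans (root_op_le n x) _.
by have /andP[_ h] := root_bnd01 n; rewrite ler_piMl ?sinorm_ge0.
Qed.

Lemma root_lim_eq x : half *: (B x + root_lim (root_lim x)) = root_lim x.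
Proof.
have h1 : tends nm (fun n => Y n (Y n x)) (root_lim (root_lim x)).
  pose c n := nm (Y n x - root_lim x)
      + nm (Y n (root_lim x) - root_lim (root_lim x)).
  apply: (tends_squeeze (c := c)) => [n|].
    rewrite -[X in nm X](subrKA (Y n (root_lim x))) (le_trans (sinormD hg _ _))//.
    rewrite lerD2r -(linB (root_op_lin n)); apply: le_trans (root_op_le n _) _.
    by have /andP[_ h] := root_bnd01 n; rewrite ler_piMl ?sinorm_ge0.
  by rewrite -(addr0 (0 : R)); apply: cvgD; exact: root_limP.
have h2 := tendsZ hV half (tendsD hV (tends_cst hV (B x)) h1).
apply: (tends_uniq hV h2); rewrite /tends.
by have := root_limP x; rewrite /tends -(cvg_shiftS).
Qed.

Lemma root_lim_comm C : islin C -> bounded_map C -> (forall x, C (B x) = B (C x)) ->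
  forall x, C (root_lim x) = root_lim (C x).
Proof.
move=> Clin [M hM] CB x; have := tends_bounded Clin hM (root_limP x).
under eq_fun do rewrite (root_op_comm _ Clin CB).
by move/(tends_uniq hV); apply; exact: root_limP.
Qed.

End Iteration.

(** For symmetric [A] the contraction hypothesis means 0 <= A <= 2. The root inherits it, so roots
    can be iterated; the commutation clause stands in for a functional calculus. *)
Lemma bounded_root (A : V -> V) : islin A -> symmetric_map A ->
  (forall x, nm (x - A x) <= nm x) ->
  exists r : V -> V, [/\ islin r, symmetric_map r, forall x, r (r x) = A x,
    forall x, nm (x - r x) <= nm x &
    forall C, islin C -> bounded_map C -> (forall x, C (A x) = A (C x)) ->
      forall x, C (r x) = r (C x)].
Proof.
move=> Alin Asym Acontr; pose B x := x - A x.
have Blin : islin B.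
  by move=> a x y; rewrite /B Alin scalerBr opprD addrACA.
have Bsym : symmetric_map B by move=> x y; rewrite /B (siBl hg) (siBr hg) Asym.
have Ylin := root_lim_lin Blin Acontr.
exists (fun x => x - root_lim Blin Acontr x); split.
- by move=> a x y; rewrite Ylin scalerBr opprD addrACA.
- by move=> x y; rewrite (siBl hg) (siBr hg) root_lim_sym.
- move=> x; rewrite (linB Ylin).
  have := half_double (root_lim_eq Blin Acontr x); rewrite /B.
  set y := root_lim _ _ _; set z := root_lim _ _ _ => h.
  by rewrite opprB addrACA -opprD -h opprD addrACA subrr addr0 subKr.
- by move=> x; rewrite subKr root_lim_le.
- move=> C Clin hC CA x; rewrite (linB Clin) (root_lim_comm Blin)// => z.
  by rewrite /B (linB Clin) CA.
Qed.

End BoundedRoot.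

(** * Positive self-adjoint relations, their square roots, and T^* T *)

Section Relations.
Context {R : realType} {V : lmodType R[i]} {rp : V -> V -> R}.
Hypothesis hV : real_hilbert rp.
Local Notation nm := (sinorm rp).
Let hg : semi_inner rp := rh_si hV.
Implicit Types (x y z v w : V) (A G P S T : set (V * V)).

(* [op_dom] and [op_comp] over a vector space without topology *)
Definition rel_dom G : set V := [set x | exists y, G (x, y)].
Definition rel_comp G T : set (V * V) := [set p | exists2 y, T (p.1, y) & G (y, p.2)].
Definition radj G : set (V * V) :=
  [set p | forall x y, G (x, y) -> rp y p.1 = rp x p.2].
Definition symmetric_rel A := forall p q, A p -> A q -> rp p.2 q.1 = rp p.1 q.2.
Definition positive_rel A := forall p, A p -> 0 <= rp p.2 p.1.
(** For a subspace this is density, by [orth_dense]. *)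
Definition orth_trivial (X : set V) := forall x, (forall y, X y -> rp y x = 0) -> x = 0.

Record pos_selfadjoint P : Prop := PosSelfadjoint {
  psa_lin : linear_subspace P;
  psa_dom : orth_trivial (rel_dom P);
  psa_adj : radj P = P;
  psa_pos : positive_rel P }.

(** Surjectivity of 1 + A expresses maximality and provides the bounded resolvent from which square
    roots are built. *)
Record pos_maximal A : Prop := PosMaximal {
  pm_lin : linear_subspace A;
  pm_sym : symmetric_rel A;
  pm_pos : positive_rel A;
  pm_onto : forall v, exists2 p, A p & p.1 + p.2 = v;
  pm_op : operator_on A }.

Lemma radj_lin G : linear_subspace G -> linear_subspace (radj G).
Proof.
move=> hG; split=> [x y _|a [x y] [x' y'] h h' z w Gzw] /=.
  by rewrite !(si0r hg).
rewrite !(siDr hg) (h' _ _ Gzw)/=; congr (_ + _).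
have := h _ _ (subspaceZ hG a^* Gzw).
by rewrite /= !(rp_conj hV) conjCK.
Qed.

Lemma radj_closed G : closed_rel (rp := rp) (radj G).
Proof.
move=> u p hu [h1 h2] x y Gxy.
have := tends_rpr hV (y := x) h2; under eq_fun do rewrite -(hu _ _ _ Gxy).
move=> h; exact: cvg_seq_unique (tends_rpr hV (y := y) h1) h.
Qed.

Lemma psa_closed P : pos_selfadjoint P -> closed_rel (rp := rp) P.
Proof. by move=> hP; rewrite -(psa_adj hP); exact: radj_closed. Qed.

Lemma psa_sym P : pos_selfadjoint P -> symmetric_rel P.
Proof.
by move=> hP [x y] q Pp; rewrite -{1}(psa_adj hP) => /(_ _ _ Pp).
Qed.

Lemma radj_op G : orth_trivial (rel_dom G) -> operator_on (radj G).
Proof.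
move=> dG y h; apply: dG => x [z Gxz]; have := h _ _ Gxz => /= <-.
by rewrite (si0r hg).
Qed.

Lemma psa_op P : pos_selfadjoint P -> operator_on P.
Proof. by move=> hP; rewrite -(psa_adj hP); apply: radj_op (psa_dom hP). Qed.

(** Positivity makes |p.1 + p.2| dominate both coordinates on [P], so the Riesz sequence converges
    in the graph. The residue w is orthogonal to the range of 1 + P, so (w, -w) lies in the adjoint,
    which is [P], and positivity forces w = 0. *)
Lemma psa_maximal P : pos_selfadjoint P -> pos_maximal P.
Proof.
move=> hP; split; [exact: psa_lin|exact: psa_sym|exact: psa_pos| |exact: psa_op].
move=> v; pose g (p q : V * V) : R := rp (p.1 + p.2) (q.1 + q.2).
have gsi : semi_inner g.
  split=> [p q r|p q|a p q|p]; rewrite /g /=.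
  - by rewrite !(siE hg); lra.
  - by rewrite (siC hg).
  - by rewrite -scalerDr (siZ hg).
  - exact: si_ge0.
have gle p : P p -> nm p.1 <= sinorm g p /\ nm p.2 <= sinorm g p.
  move=> Pp; have := psa_pos hP Pp.
  have := si_ge0 hg p.1; have := si_ge0 hg p.2.
  rewrite (siC hg p.2) => h1 h2 h3.
  by split; rewrite ler_sqrt ?(si_ge0 gsi)// /g !(siE hg) (siC hg p.2 p.1); lra.
have [|a x _|x _|u [Pu cu hu]] :=
    riesz_sequence (L := fun q => rp (q.1 + q.2) v) (M := nm v) gsi (psa_lin hP).
- by move=> x y _ _; rewrite /= !(siE hg); lra.
- by rewrite /= !(siE hg); lra.
- by rewrite mulrC; exact: (si_ler hg).
have Pd m n : P (u m - u n) by exact: (subspaceB (psa_lin hP)).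
have [|| p up] := cauchy_pair hV (u := u).
- move=> e /cu[n0 hn]; exists n0 => m n hm /(hn _ _ hm); apply: le_lt_trans.
  exact: (gle _ (Pd m n)).1.
- move=> e /cu[n0 hn]; exists n0 => m n hm /(hn _ _ hm); apply: le_lt_trans.
  exact: (gle _ (Pd m n)).2.
have Pp := psa_closed hP Pu up; exists p => //.
pose w := v - (p.1 + p.2).
suff w0 : w = 0 by apply/esym/eqP; rewrite -subr_eq0 -/w w0.
have Pw : P (w, - w).
  rewrite -(psa_adj hP) => x y Pxy /=; apply/eqP.
  rewrite (siNr hg) -addr_eq0 addrC -(siDl hg) /w (siBr hg) subr_eq0; apply/eqP.
  apply: cvg_seq_unique (hu _ Pxy) _.
  by apply: (tends_rpr hV); exact: (tendsD hV up.1 up.2).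
have := psa_pos hP Pw; rewrite /= (siNl hg) oppr_ge0 => h.
by apply: (rh_eq0 hV); apply/eqP; rewrite eq_le h (si_ge0 hg).
Qed.

(** [f] is (1 + A)^-1. It is well defined because a pair (x, -x) of [A] has -|x|^2 >= 0, and both
    contraction bounds follow from <f v, v - f v> >= 0. *)
Lemma pos_maximal_resolvent A : pos_maximal A -> exists f : V -> V,
  [/\ islin f, symmetric_map (rp := rp) f, forall p, A p <-> p.1 = f (p.1 + p.2),
      (forall v, nm (f v) <= nm v) /\ (forall v, nm (v - f v) <= nm v)
    & forall v, f v = 0 -> v = 0].
Proof.
case=> Al As Ap Ao Aop.
have uni p q : A p -> A q -> p.1 + p.2 = q.1 + q.2 -> p = q.
  move=> Ap_ Aq e; have Ad := subspaceB Al Ap_ Aq.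
  have e2 : (p - q).2 = - (p - q).1.
    rewrite /= opprB; apply/eqP; rewrite subr_eq addrAC eq_sym subr_eq -e.
    by rewrite addrC.
  have := Ap _ Ad; rewrite e2 (siNl hg) oppr_ge0 => h.
  have e1 : (p - q).1 = 0.
    by apply: (rh_eq0 hV); apply/eqP; rewrite eq_le h (si_ge0 hg).
  apply/eqP; rewrite -subr_eq0; apply/eqP.
  by rewrite [p - q]surjective_pairing e2 e1 oppr0.
have [f fP] := choice (fun v => let: ex_intro2 p h1 h2 := Ao v in
   ex_intro (fun p => A p /\ p.1 + p.2 = v) p (conj h1 h2)).
have Af p : A p -> f (p.1 + p.2) = p.
  by move=> Ap_; apply: uni => //; [exact: (fP _).1|exact: (fP _).2].
have f2 v : (f v).2 = v - (f v).1 by rewrite -{2}(fP v).2 addrC addKr.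
have ge v : 0 <= rp (f v).1 (v - (f v).1).
  by rewrite -f2 (siC hg); apply: Ap; exact: (fP v).1.
exists (fun v => (f v).1); split.
- move=> a x y; rewrite -[RHS]/((a *: f x + f y).1); congr (_.1).
  have /Af <- : A (a *: f x + f y) by apply: Al.2; exact: (fP _).1.
  congr f; rewrite /= -{1}(fP x).2 -{1}(fP y).2 scalerDr.
  by rewrite addrACA.
- move=> x y; have := As _ _ (fP x).1 (fP y).1; rewrite !f2 (siBl hg) (siBr hg).
  by move=> /addIr ->.
- move=> p; split; first by move=> /Af ->.
  move=> e; suff -> : p = f (p.1 + p.2) by exact: (fP _).1.
  by rewrite [p in LHS]surjective_pairing {1}e [RHS]surjective_pairing f2 -e addrC addKr.
- split=> v; rewrite ler_sqrt ?(si_ge0 hg)//; have := ge v;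
  have := si_ge0 hg (f v).1; have := si_ge0 hg (v - (f v).1);
  rewrite !(siE hg) (siC hg v); lra.
- move=> v f0; have := f2 v; rewrite f0 subr0 => e.
  have : A (0, v) by rewrite -e -f0 -surjective_pairing; exact: (fP v).1.
  exact: Aop.
Qed.

(* [A] consists of the pairs [(f v, v - f v)] with [f] its resolvent, and the
   square root of the pairs [(sqrt f v, sqrt (1 - f) v)]. *)
Lemma pos_maximal_root A : pos_maximal A ->
  exists2 P, pos_selfadjoint P & rel_comp P P = A.
Proof.
move=> /pos_maximal_resolvent[f [fl fs fA [fc1 fc2] f0]].
have flB : islin (fun x => x - f x).
  by move=> a x y; rewrite fl scalerBr opprD addrACA.
have bnd (h : V -> V) : (forall x, nm (x - h x) <= nm x) -> bounded_map (rp := rp) h.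
  move=> hc; exists 2 => x; rewrite -{1}(subKr x (h x)).
  by apply: le_trans (sinormB hg _ _) _; have := hc x; lra.
have [r [rl rs r2 rc rC]] := bounded_root hV fl fs fc2.
have [||s [sl ss s2 sc sC]] := bounded_root hV flB.
- by move=> x y; rewrite (siBl hg) (siBr hg) fs.
- by move=> x; rewrite subKr.
(* A fourth root of f: it turns <s z, r z> into <s (t z), t z>, whose sign is known. *)
have [t [tl ts t2 _ tC]] := bounded_root hV rl rs rc.
have fb : bounded_map (rp := rp) f by exists 1 => x; rewrite mul1r.
have fsC x : f (s x) = s (f x) by apply: sC => // z; rewrite (linB fl).
have srC x : s (r x) = r (s x) by apply: rC => //; exact: bnd.
have stC x : s (t x) = t (s x) by apply: tC => //; exact: bnd.
have r0 z : r z = 0 -> z = 0.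
  by move=> e; apply: f0; rewrite -r2 e (lin0 rl).
have rs1 z : r (r z) + s (s z) = z by rewrite r2 s2 addrC subrK.
pose P : set (V * V) := [set p | exists z, p = (r z, s z)].
exists P; first split.
- split; first by exists 0; rewrite (lin0 rl) (lin0 sl).
  by move=> a _ _ [z ->] [w ->]; exists (a *: z + w); rewrite rl sl.
- move=> x h; apply: r0; apply: (rh_eq0 hV); rewrite rs r2 (siC hg) -r2.
  by apply: h; exists (s (r x)); exists (r x).
- apply/seteqP; split => [[x y] /= h|_ [z ->] _ _ [w [-> ->]] /=]; last first.
    by rewrite ss srC -rs.
  have e : s x = r y.
    apply/eqP; rewrite -subr_eq0; apply/eqP; apply: (rp_eq0 hV) => z.
    rewrite (siBl hg) ss rs (siC hg x) (siC hg y).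
    by apply/eqP; rewrite subr_eq0; apply/eqP; apply: h; exists z.
  (* The solution of r z = x, s z = y, given s x = r y and r^2 + s^2 = 1. *)
  exists (r x + s y); rewrite (linD rl) (linD sl); congr pair.
    by rewrite -srC -e rs1.
  by rewrite srC e rs1.
- move=> _ [z ->] /=; rewrite -t2 -ts -stC.
  have := sc (t z); rewrite (sinorm_sqrle hg) ?sinorm_ge0// (sinormE hg) !(siE hg).
  by rewrite (siC hg (t z) (s _)); have := si_ge0 hg (s (t z)); lra.
apply/seteqP; split => [[x y] [_ [z [-> ->]] [w [e ->]]]|[x y] /fA /= e].
  by apply/fA => /=; rewrite -r2 (linD rl) -srC -e rs1.
exists (s (r (x + y))).
  by exists (r (x + y)); rewrite r2 -e.
by exists (s (x + y)); rewrite srC s2 -e [x + y - x]addrC addKr.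
Qed.

(* von Neumann's theorem *)
Lemma radj_comp_maximal T : linear_subspace T -> closed_rel (rp := rp) T ->
  operator_on T -> orth_trivial (rel_dom T) -> pos_maximal (rel_comp (radj T) T).
Proof.
move=> Tl Tc To Td; have Tal := radj_lin Tl; split.
- split; first by exists 0; [exact: Tl.1|exact: Tal.1].
  move=> a [x y] [x' y'] [z Tz Az] [z' Tz' Az'].
  by exists (a *: z + z'); [exact: (Tl.2 a _ _ Tz Tz')|exact: (Tal.2 a _ _ Az Az')].
- move=> [x y] [x' y'] [z Tz Az] [z' Tz' Az'] /=.
  by rewrite -(Az' _ _ Tz) (siC hg y) -(Az _ _ Tz') (siC hg).
- by move=> [x y] [z Tz Az] /=; rewrite (siC hg) -(Az _ _ Tz) (si_ge0 hg).
- move=> v; have [|a x _|x _|u [Tu /(cauchy_graph hV)[p up] hu]] :=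
    riesz_sequence (L := fun q => rp q.1 v) (M := nm v) (graph_inner_semi hV) Tl.
  + by move=> x y _ _; rewrite /= (siDl hg).
  + by rewrite /= (siZ hg).
  + rewrite mulrC; apply: le_trans (si_ler hg _ _) _.
    by rewrite ler_wpM2r ?sinorm_ge0// (nm_fst hV).
  have Tp : T p := Tc _ _ Tu up.
  (* The Riesz identity <x, v> = <x, p.1> + <T x, p.2> says that the adjoint of T sends p.2 to v -
     p.1. *)
  exists (p.1, v - p.1); last by rewrite /= addrC subrK.
  exists p.2; first by case: (p) Tp.
  move=> x y Txy /=; 
  have := cvg_seq_unique (hu _ Txy) (tends_graph_inner hV (q := (x, y)) up).
  by rewrite /graph_inner /= (siBr hg); lra.
- move=> y [z /To -> Az]; apply: Td => x [w Txw].
  by have := Az _ _ Txw; rewrite /= (si0r hg).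
Qed.

(** D(T^* T) is a core of T: if (q1, q2) in T is graph-orthogonal to T restricted to it, solve x +
    T^* T x = q1; then <q1, q1> is the graph inner product of (x, T x) and (q1, q2), which is 0. *)
Lemma radj_comp_core T p : linear_subspace T -> closed_rel (rp := rp) T ->
  operator_on T -> orth_trivial (rel_dom T) -> T p ->
  exists2 u, forall n, T (u n) /\ (exists w, radj T ((u n).2, w)) &
    tends_pair (rp := rp) u p.
Proof.
move=> Tl Tc To Td Tp; have Tal := radj_lin Tl.
apply: (core_sequence hV (G0 := [set q | T q /\ exists w, radj T (q.2, w)])) Tp => //.
- split; first by split; [exact: Tl.1|exists 0; exact: Tal.1].
  move=> a x y [Tx [w Aw]] [Ty [w' Aw']]; split; first exact: Tl.2.
  by exists (a *: w + w'); exact: (Tal.2 a _ _ Aw Aw').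
- by move=> q [].
move=> [q1 q2] Tq h.
have [[x w] [y Txy Ayw] /= xw] := pm_onto (radj_comp_maximal Tl Tc To Td) q1.
have q10 : q1 = 0.
  apply: (rh_eq0 hV); rewrite -{1}xw (siDl hg).
  have := h (x, y) (conj Txy (ex_intro _ w Ayw)); rewrite /graph_inner /= => <-.
  by rewrite (siC hg w) -(Ayw _ _ Tq) (siC hg y).
by rewrite q10; congr pair; apply: To; rewrite -q10.
Qed.

(** On D(T^* T) one has |T x|^2 = <T^* T x, x> = |S x|^2, and this domain is a core. Applied both
    ways it gives D(T) = D(|T|). *)
Lemma radj_comp_dom T S x y :
  linear_subspace T -> closed_rel (rp := rp) T -> operator_on T ->
  orth_trivial (rel_dom T) ->
  linear_subspace S -> closed_rel (rp := rp) S -> operator_on S ->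
  rel_comp (radj T) T = rel_comp (radj S) S ->
  T (x, y) -> exists2 z, S (x, z) & nm z <= nm x + nm y.
Proof.
move=> Tl Tc To Td Sl Sc So e Txy; have Tal := radj_lin Tl.
suff : exists2 z, S (x, z) & nm z <= 1 * (nm x + nm y).
  by case=> z Sz; rewrite mul1r; exists z.
apply: (core_transfer hV (G0 := [set q | T q /\ exists w, radj T (q.2, w)])
  (G1 := T)) Txy => //.
- split; first by split; [exact: Tl.1|exists 0; exact: Tal.1].
  move=> a p q [Tx [w Aw]] [Ty [w' Aw']]; split; first exact: Tl.2.
  by exists (a *: w + w'); exact: (Tal.2 a _ _ Aw Aw').
- move=> {}x {}y [Txy [w Aw]].
  have [z Sz Bz] : rel_comp (radj S) S (x, w) by rewrite -e; exists y.
  exists z => //; rewrite mul1r (@le_trans _ _ (nm y)) ?lerDr ?sinorm_ge0//.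
  by rewrite /sinorm (Bz _ _ Sz) (Aw _ _ Txy).
- by move=> p Tp; apply: radj_comp_core.
Qed.

End Relations.

(** * Krein's theorem on symmetrizable operators *)

Lemma bernoulli_ineq {R : realDomainType} (h : R) n : 0 <= h -> 1 + h *+ n <= (1 + h) ^+ n.
Proof.
move=> h0; elim: n => [|n IH]; first by rewrite mulr0n addr0 expr0.
rewrite exprS mulrS; have : 0 <= h *+ n by rewrite mulrn_wge0.
move: IH; move: (h *+ n) (_ ^+ n) => a b; nra.
Qed.

(** Log-convexity makes the ratios b(n+1)/b(n) nondecreasing, so a first ratio above [D] would make
    b outgrow every multiple of D^n. *)
Lemma log_convex_ratio {R : realType} (b : nat -> R) (M D : R) : 0 <= D ->
  (forall n, 0 <= b n) -> (forall n, b n.+1 ^+ 2 <= b n * b n.+2) ->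
  (forall n, b n <= M * D ^+ n) -> b 1%N <= D * b 0%N.
Proof.
move=> D0 b0 bc bM; rewrite leNgt; apply/negP => h.
have b1 : 0 < b 1%N by apply: le_lt_trans h; rewrite mulr_ge0.
have b00 : 0 < b 0%N.
  rewrite lt_neqAle b0 andbT eq_sym; apply/eqP => e.
  by have := bc 0%N; rewrite e mul0r; nra.
have Dp : 0 < D.
  rewrite lt_neqAle D0 andbT eq_sym; apply/eqP => e.
  by have := bM 1%N; rewrite e expr1 mulr0; lra.
have key n : 0 < b n /\ b n * b 1%N <= b n.+1 * b 0%N.
  elim: n => [|n [bn IH]]; first by split => //; rewrite mulrC.
  have bn1 : 0 < b n.+1.
    by rewrite -(pmulr_lgt0 _ b00); apply: lt_le_trans IH; rewrite mulr_gt0.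
  split => //; rewrite -(ler_pM2l bn).
  have := ler_wpM2l (ltW bn1) IH; have := ler_wpM2r (b0 0%N) (bc n); lra.
pose q := b 1%N / (D * b 0%N).
have q1 : 1 < q by rewrite /q ltr_pdivlMr ?mulr_gt0// mul1r.
have qb n : q ^+ n * D ^+ n * b 0%N <= b n.
  elim: n => [|n IH]; first by rewrite !expr0 !mul1r.
  have [_] := key n; rewrite -ler_pdivrMr//; apply: le_trans.
  rewrite ler_pdivlMr//; apply: le_trans (ler_wpM2r (b0 1%N) IH).
  rewrite !exprS; set x := _ ^+ n; set y := _ ^+ n.
  suff <- : q * (D * b 0%N) = b 1%N by lra.
  by rewrite /q; field; rewrite !gt_eqF.
have qM n : q ^+ n <= M / b 0%N.
  rewrite ler_pdivlMr// -(ler_pM2r (exprn_gt0 n Dp)).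
  by apply: le_trans (bM n); rewrite mulrAC; apply: le_trans (qb n).
have h0 : 0 < q - 1 by rewrite subr_gt0.
have [n hn] : exists n : nat, M / b 0%N / (q - 1) < n%:R.
  exists (Num.truncn (M / b 0%N / (q - 1))).+1; exact: truncnS_gt.
have := qM n; have := bernoulli_ineq n (ltW h0).
rewrite addrCA subrr addr0 -mulr_natr; move: hn; rewrite ltr_pdivrMr//.
by rewrite mulrC; lra.
Qed.

Section Dominated.
Context {R : realType} {V : lmodType R[i]} {rp : V -> V -> R}.
Hypothesis hV : real_hilbert rp.
Local Notation nm := (sinorm rp).
Let hg : semi_inner rp := rh_si hV.
Implicit Types (x y z v w : V) (A K : set (V * V)).

(* Krein's argument: [G = A^-1 K] is symmetric for the form [<A x, x>] and bounded
   by [C] in norm, hence bounded by [C] for that form, as one sees from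
   [<A G^n x, G^n x> = <A x, G^2n x> <= |A x| C^2n |x|]. *)
Lemma symmetric_dominated A K (C : R) x y z : 0 <= C ->
  linear_subspace A -> symmetric_rel (rp := rp) A -> positive_rel (rp := rp) A ->
  (forall v, exists w, A (w, v)) ->
  symmetric_rel (rp := rp) K -> (forall x y, A (x, y) -> exists z, K (x, z)) ->
  (forall x y z, A (x, y) -> K (x, z) -> nm z <= C * nm y) ->
  A (x, y) -> K (x, z) -> rp z x <= C * rp y x.
Proof.
move=> C0 Al As Ap Ao Ks AK KC Axy Kxz.
(* A triple is (x, A x, K x); a step keeps the old K x as the new A x, so that X(n+1) = A^-1 K
   X(n). *)
pose good (t : V * V * V) := A t.1 /\ K (t.1.1, t.2).
have hstep (t : V * V * V) : exists t', good t' /\ t'.1.2 = t.2.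
  have [w Aw] := Ao t.2; have [w' Kw] := AK _ _ Aw.
  by exists (w, t.2, w').
have [step stepP] := choice hstep.
pose t n := iter n step (x, y, z).
have tP n : good (t n) by case: n => [|n] //=; exact: (stepP _).1.
have tS n : (t n.+1).1.2 = (t n).2 by exact: (stepP _).2.
pose X n := (t n).1.1; pose Y n := (t n).1.2; pose Z n := (t n).2.
have AX n : A (X n, Y n) by have [] := tP n; rewrite /X /Y; case: (t n).1.
have KX n : K (X n, Z n) by have [] := tP n.
(* Since A^-1 K is symmetric for <A x, x>, these moments satisfy <A X(m), X(n)> = a(m+n). *)
pose a n := rp (Y 0%N) (X n).
have aE m n : rp (Y m) (X n) = a (m + n)%N.
  elim: m n => [|m IH] n; first by rewrite add0n.
  rewrite addSn -addnS -IH (As _ _ (AX m) (AX n.+1)) /= [Y m.+1]tS [Y n.+1]tS.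
  exact: (Ks _ _ (KX m) (KX n)).
(* [KC] bounds K A^-1; the bound passes to A^-1 K by duality, |X(n+1)|^2 = <X(n), K w> with A w =
   X(n+1). *)
have XC n : nm (X n.+1) <= C * nm (X n).
  have [w Aw] := Ao (X n.+1); have [w' Kw] := AK _ _ Aw.
  have := As _ _ (AX n.+1) Aw; rewrite /= [Y n.+1]tS (Ks _ _ (KX n) Kw) /= => e.
  have := si_ler hg (X n) w'; rewrite e -(sinormE hg) expr2 => h.
  have [->|x0] := eqVneq (nm (X n.+1)) 0; first by rewrite mulr_ge0 ?sinorm_ge0.
  have x1 : 0 < nm (X n.+1) by rewrite lt_neqAle eq_sym x0 sinorm_ge0.
  rewrite -(ler_pM2r x1); apply: le_trans h _.
  by have := ler_wpM2l (sinorm_ge0 (g:=rp) (X n)) (KC _ _ _ Aw Kw); lra.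
have XCn n : nm (X n) <= C ^+ n * nm (X 0%N).
  elim: n => [|n IH]; first by rewrite expr0 mul1r.
  by rewrite exprS -mulrA; apply: le_trans (XC n) _; rewrite ler_wpM2l.
have CS m n : a (m + n)%N ^+ 2 <= a (m + m)%N * a (n + n)%N.
  rewrite -!aE; apply: quadratic_ge0_discr => [|s]; first exact: Ap (AX n).
  have := Ap _ (subspaceD Al (AX m) (subspaceZ Al (real_complex R s) (AX n))).
  rewrite /= !(siE hg) !aE (addnC n m); lra.
(* The even moments are log-convex and grow at most like C^(2n), so a(2) <= C^2 a(0); Cauchy-Schwarz
   then gives a(1) <= C a(0). *)
pose b n := a (n + n)%N.
have bM n : b n <= (nm (Y 0%N) * nm (X 0%N)) * (C ^+ 2) ^+ n.
  apply: le_trans (si_ler hg _ _) _; rewrite -mulrA ler_wpM2l ?sinorm_ge0//.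
  by apply: le_trans (XCn _) _; rewrite mulrC -exprM mul2n addnn.
have h1 : b 1%N <= C ^+ 2 * b 0%N.
  apply: log_convex_ratio bM => [|n|n]; first exact: sqr_ge0.
    by rewrite /b -aE; exact: Ap (AX n).
  by have := CS n n.+2; rewrite /b !addSn !addnS.
have b00 : 0 <= b 0%N by rewrite /b -aE; exact: Ap (AX 0%N).
have a1 : a 1%N = rp z x.
  by rewrite -(aE 1%N 0%N) [Y 1%N]tS.
rewrite -a1 -[rp y x]/(b 0%N); apply: le_trans (ler_norm _) _.
rewrite -ler_sqr ?nnegrE ?mulr_ge0// real_normK ?num_real//.
apply: le_trans (CS 0%N 1%N) _.
by have := ler_wpM2l b00 h1; rewrite /b /= exprMn; lra.
Qed.

End Dominated.

(** * A closed graph theorem by nested balls *)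

Section ClosedGraph.
Context {R : realType} {V : lmodType R[i]} {rp : V -> V -> R}.
Hypothesis hV : real_hilbert rp.
Local Notation nm := (sinorm rp).
Let hg : semi_inner rp := rh_si hV.
Implicit Types (x y z : V).

(* Uniform boundedness: otherwise nested [p]-balls on which [nm (f z)] exceeds
   [n] shrink to a point. *)
Lemma closed_graph_bounded (p : V -> R) (f : V -> V) (Y : set V) :
  (forall x, 0 <= p x) -> (forall x y, p (x + y) <= p x + p y) ->
  (forall (a : R) x, p (real_complex R a *: x) = `|a| * p x) ->
  (forall u, cauchy_for p u -> exists l, tends p u l) ->
  islin f ->
  (forall x, exists2 u : nat -> V, forall n, Y (u n) & tends nm u x) ->
  (forall y, Y y -> exists M : R, forall x, `|rp (f x) y| <= M * p x) ->
  exists2 C : R, 0 <= C & forall x, nm (f x) <= C * p x.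
Proof.
move=> p0 pD pZ pc fl Yd fY; apply: contrapT => nb.
have pN x : p (- x) = p x.
  have := pZ (-1) x; rewrite rmorphN1 scaleN1r => ->.
  by rewrite normrN1 mul1r.
have p00 : p 0 = 0 by have := pZ 0 0; rewrite rmorph0 scale0r normr0 mul0r.
have big (C : R) : 0 <= C -> exists x, C * p x < nm (f x).
  move=> C0; apply: contrapT => h; apply: nb; exists C => // x.
  by rewrite leNgt; apply/negP => hx; apply: h; exists x.
(* A state is a ball, given by centre and radius; the positivity premise makes the step total, with
   value (0, 0) at nonpositive radii. *)
have hstep (s : V * R) (n : nat) : exists s' : V * R, 0 < s.2 ->
  [/\ 0 < s'.2, p (s'.1 - s.1) + s'.2 <= s.2, s'.2 <= n.+1%:R^-1 &
   forall z, p (z - s'.1) <= s'.2 -> n%:R <= nm (f z)].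
  case: s => x r /=; have [r0|] := ltP 0 r; last by exists (0, 0).
  have n3 : 0 < n%:R + 3 :> R by rewrite ltr_wpDl.
  have hr : 0 <= (n%:R + 3) * (2 / r) by rewrite mulr_ge0 ?divr_ge0 ?(ltW r0) ?(ltW n3).
  have [w hw] := big _ hr.
  have w0 : 0 < nm (f w) by apply: le_lt_trans hw; rewrite mulr_ge0.
  (* Of the 3 units, one pays for |y| >= n + 2, one for replacing <f x', y> by |y|^2, and one for
     the variation of <f z, y> over the new ball. *)
  pose xi := real_complex R ((n%:R + 3) / nm (f w)) *: w.
  have pxi : p xi <= r / 2.
    rewrite /xi pZ ger0_norm ?divr_ge0 ?(ltW w0) ?(ltW n3)// mulrAC ler_pdivrMr//.
    have -> : (n%:R + 3) * p w = r / 2 * ((n%:R + 3) * (2 / r) * p w).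
      by field; rewrite gt_eqF.
    by rewrite ler_wpM2l ?divr_ge0 ?(ltW r0) ?(ltW hw).
  have fxi : nm (f xi) = n%:R + 3.
    rewrite /xi (linZ fl) (sinormZ hg) ger0_norm ?divr_ge0 ?(ltW w0) ?(ltW n3)//.
    by rewrite divfK ?gt_eqF.
  (* One of x + xi and x - xi works, since their images differ by 2 f xi. *)
  have [x' px' fx'] : exists2 x', p (x' - x) <= r / 2 & n%:R + 3 <= nm (f x').
    have [h|h] := leP (n%:R + 3) (nm (f (x + xi))).
      by exists (x + xi) => //; rewrite addrAC subrr add0r.
    exists (x - xi); first by rewrite addrAC subrr add0r pN.
    have := sinormB hg (f (x + xi)) (f (x - xi)).
    have -> : f (x + xi) - f (x - xi) = real_complex R 2 *: f xi.
      rewrite -(linB fl) opprB addrC addrA subrK (linD fl).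
      by rewrite rmorph_nat scaler_nat mulr2n.
    by rewrite (sinormZ hg) fxi ger0_norm//; lra.
  have [u Yu fu] := Yd (f x').
  have /tendsP/(_ _ ltr01)[|n0 hn0] := fu; first by move=> ?; exact: sinorm_ge0.
  have yv := hn0 n0 (leqnn _); have Yy := Yu n0.
  move: (u n0) yv Yy => y yv Yy; have [M hM] := fY y Yy.
  have y2 : n%:R + 2 <= nm y.
    by have := sinorm_triB hg (f x') y; rewrite (sinormC hg); lra.
  have M1 : 0 < `|M| + 1 by rewrite ltr_wpDl.
  (* The three bounds keep the ball nested, make the radii tend to 0, and bound |<f (z - x'), y>| by
     1. *)
  exists (x', Num.min (r / 2) (Num.min n.+1%:R^-1 (`|M| + 1)^-1)) => _ /=; split.
  - by rewrite !lt_min !invr_gt0 M1 ltr0n divr_gt0.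
  - rewrite -[leRHS]/r; have : Num.min (r / 2) (Num.min n.+1%:R^-1 (`|M| + 1)^-1) <= r / 2.
      by rewrite ge_min lexx.
    by move: (Num.min _ _) => m; lra.
  - by rewrite !ge_min lexx orbT.
  move=> z; rewrite !le_min => /and3P[_ _ hz].
  have hMz : M * p (z - x') <= 1.
    have : `|M| * p (z - x') <= 1.
      have := ler_wpM2l (normr_ge0 M) hz; move=> /le_trans; apply.
      by rewrite ler_pdivrMr// mul1r lerDl.
    by apply: le_trans; rewrite ler_wpM2r// ler_norm.
  have := hM (z - x'); rewrite (linB fl) (siBl hg) => /(le_trans (ler_norm _)).
  have := hM (x' - z); rewrite (linB fl) (siBl hg) => /(le_trans (ler_norm _)).
  rewrite -(pN (x' - z)) opprB => h1 _.
  have h2 := si_ler hg (f z) y.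
  have h3 := si_ler hg (y - f x') y; rewrite (siBl hg) -(sinormE hg) (sinormC hg) in h3.
  have n0' : 0 <= n%:R :> R by [].
  have h4 : nm (f x' - y) * nm y <= nm y.
    by rewrite ler_piMl ?sinorm_ge0// (sinormC hg) (ltW yv).
  rewrite -(ler_pM2r (_ : 0 < nm y)); last by lra.
  apply: le_trans h2; nra.
have [step stepP] := choice (fun sn : (V * R) * nat => hstep sn.1 sn.2).
pose s := fix s n : V * R := if n is n'.+1 then step (s n', n') else (0, 1).
have s0 n : 0 < (s n).2.
  by elim: n => [|n IH] //=; have [] := stepP (s n, n) IH.
have sP n := stepP (s n, n) (s0 n); rewrite /= in sP.
have nest m n : (n <= m)%N -> p ((s m).1 - (s n).1) + (s m).2 <= (s n).2.
  move=> /subnKC <-; elim: (m - n)%N => [|k IH].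
    by rewrite addn0 subrr p00 add0r.
  rewrite addnS; have [_ + _ _] := sP (n + k)%N; rewrite -/(s (n + k).+1).
  have := pD ((s (n + k).+1).1 - (s (n + k)%N).1) ((s (n + k)%N).1 - (s n).1).
  rewrite subrKA; move: IH; lra.
have nest' m n : (n <= m)%N -> p ((s m).1 - (s n).1) <= (s n).2.
  by move=> /nest; have := s0 m; lra.
have [l hl] : exists l, tends p (fun n => (s n).1) l.
  apply: pc => e e0; have e20 : 0 < e / 2 by rewrite divr_gt0.
  have [n0 _ hn0] := near_infty_natSinv_lt (PosNum e20).
  have r0 : (s n0.+1).2 < e / 2.
    have [_ _ h _] := sP n0; apply: le_lt_trans h _; exact: (hn0 n0 (leqnn _)).
  exists n0.+1 => m n hm hn; have := nest' _ _ hm; have := nest' _ _ hn.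
  have := pD ((s m).1 - (s n0.+1).1) (- ((s n).1 - (s n0.+1).1)).
  by rewrite pN opprB subrKA; lra.
have hln n : p (l - (s n).1) <= (s n).2.
  apply/ler_addgt0Pr => e e0; have /tendsP/(_ _ e0)[//|n0 hn0] := hl.
  have := hn0 (maxn n0 n) (leq_maxl _ _); have := nest' _ _ (leq_maxr n0 n).
  have := pD (- ((s (maxn n0 n)).1 - l)) ((s (maxn n0 n)).1 - (s n).1).
  by rewrite pN opprB subrKA; lra.
(* The ball [s n.+1] is the one on which |f z| >= n, whence the index shift below. *)
pose n := (Num.truncn (nm (f l))).+1.
have [_ _ _ /(_ _ (hln n.+1))] := sP n.
by apply/negP; rewrite -ltNge truncnS_gt.
Qed.

End ClosedGraph.

(** * The operators H M H and the domain of the root of |T| *)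

Section FormDomain.
Context {R : realType} {V : lmodType R[i]} {rp : V -> V -> R}.
Hypothesis hV : real_hilbert rp.
Local Notation nm := (sinorm rp).
Let hg : semi_inner rp := rh_si hV.
Implicit Types (x y z u v w : V) (P S T K : set (V * V)).

(* The operator [H M H], where [J] is the inverse of [H]. *)
Definition sandwich (J M : V -> V) : set (V * V) :=
  [set p | exists2 u, p.1 = J u & M u = J p.2].

Definition coercive (M : V -> V) :=
  exists2 d : R, 0 < d & forall u, d * rp u u <= rp (M u) u.

Lemma bounded_comp (f g : V -> V) : bounded_map (rp := rp) f -> bounded_map (rp := rp) g ->
  bounded_map (rp := rp) (f \o g).
Proof.
move=> [M hM] [M' hM']; exists (`|M| * M') => x /=; apply: le_trans (hM _) _.
rewrite -mulrA (le_trans (ler_wpM2r (sinorm_ge0 _) (ler_norm M)))//.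
by rewrite ler_wpM2l.
Qed.

Lemma bounded_pos (f : V -> V) : bounded_map (rp := rp) f ->
  exists2 M : R, 0 < M & forall x, nm (f x) <= M * nm x.
Proof.
move=> [M hM]; exists (`|M| + 1); first by rewrite ltr_wpDl.
move=> x; apply: le_trans (hM x) _; rewrite ler_wpM2r ?sinorm_ge0//.
by have := ler_norm M; lra.
Qed.

(** Riesz for the form <M u, w>, whose norm dominates the given one by coercivity. *)
Lemma coercive_onto (M : V -> V) : islin M -> symmetric_map (rp := rp) M ->
  coercive M -> forall v, exists u, M u = v.
Proof.
move=> Ml Ms [d d0 hd] v; pose g u w := rp (M u) w.
have gsi : semi_inner g.
  split=> [x y z|x y|a x y|x]; rewrite /g.
  - by rewrite (linD Ml) (siDl hg).
  - by rewrite Ms (siC hg).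
  - by rewrite (linZ Ml) (siZ hg).
  - by apply: le_trans (hd x); rewrite mulr_ge0 ?(ltW d0) ?(si_ge0 hg).
have ng x : nm x <= Num.sqrt d^-1 * sinorm g x.
  rewrite /sinorm -sqrtrM ?invr_ge0 ?(ltW d0)//.
  rewrite ler_sqrt ?mulr_ge0 ?invr_ge0 ?(ltW d0) ?(si_ge0 gsi)//.
  by rewrite mulrC ler_pdivlMr// mulrC; exact: hd.
have d1 : 0 < Num.sqrt d^-1 by rewrite sqrtr_gt0 invr_gt0.
have [|||x _|u [_ cu hu]] :=
  riesz_sequence (D := setT) (L := fun u => rp u v) (M := Num.sqrt d^-1 * nm v) gsi.
- by split.
- by move=> x y _ _; rewrite (siDl hg).
- by move=> a x _; rewrite (siZ hg).
- apply: le_trans (si_ler hg _ _) _; rewrite mulrAC ler_wpM2r ?sinorm_ge0//.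
have [|w uw] := rh_complete hV (u := u).
  move=> e e0; have [n0 hn] := cu _ (divr_gt0 e0 d1); exists n0 => m n hm /(hn _ _ hm).
  by rewrite ltr_pdivlMr// => h; apply: le_lt_trans (ng _) _; rewrite mulrC.
exists w; apply/eqP; rewrite -subr_eq0; apply/eqP; apply: (rp_eq0 hV) => y.
rewrite (siBl hg) Ms (siC hg) (siC hg v).
by rewrite (cvg_seq_unique (hu y I) (tends_rpr hV (y := M y) uw)) subrr.
Qed.

Section Sandwich.
Variable J : V -> V.
Hypotheses (Jl : islin J) (Jb : bounded_map (rp := rp) J) (Js : symmetric_map (rp := rp) J).
Hypothesis J0 : forall u, J u = 0 -> u = 0.

Lemma J_inj u v : J u = J v -> u = v.
Proof.
move=> e; apply/eqP; rewrite -subr_eq0; apply/eqP; apply: J0.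
by rewrite (linB Jl) e subrr.
Qed.

(** By symmetry, a vector orthogonal to the range of [J] lies in its kernel. *)
Lemma J_dense x : exists2 u : nat -> V, forall n, range J (u n) & tends nm u x.
Proof.
apply: (orth_dense hV) => [|{}x h].
  split; first by exists 0 => //; exact: lin0.
  by move=> a _ _ [u _ <-] [v _ <-]; exists (a *: u + v).
apply: J0; apply: (rp_eq0 hV) => y; rewrite Js (siC hg); apply: h.
by exists y.
Qed.

Lemma sandwich_lin M : islin M -> linear_subspace (sandwich J M).
Proof.
move=> Ml; split; first by exists 0; rewrite /= ?(lin0 Jl) ?(lin0 Ml).
move=> a p q [u pu Mu] [v qv Mv]; exists (a *: u + v); rewrite /= Jl.
  by rewrite pu qv.
by rewrite Ml Mu Mv.
Qed.

Lemma sandwich_sym M : symmetric_map (rp := rp) M ->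
  symmetric_rel (rp := rp) (sandwich J M).
Proof.
by move=> Ms p q [u pu Mu] [v qv Mv]; rewrite pu qv -Js -Mu Ms Mv Js.
Qed.

Lemma sandwich_form M x z u : sandwich J M (x, z) -> x = J u -> rp z x = rp (M u) u.
Proof. by move=> [v /= -> e] /J_inj <-; rewrite -Js -e. Qed.

Lemma sandwich_onto M : (forall v, exists u, M u = v) ->
  forall v, exists w, sandwich J M (w, v).
Proof. by move=> Mo v; have [u Mu] := Mo (J v); exists (J u); exists u. Qed.

Section Perturbed.
Variables Q B F Fi : V -> V.
Hypotheses (Ql : islin Q) (Bl : islin B) (Bb : bounded_map (rp := rp) B).
Hypothesis FE : forall u, F u = Q u + J (B (J u)).
Hypotheses (FK : cancel F Fi) (FiK : cancel Fi F) (Fib : bounded_map (rp := rp) Fi).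

Lemma F_lin : islin F.
Proof. by move=> a x y; rewrite !FE Jl Bl Jl Ql scalerDr addrACA. Qed.
Lemma Fi_lin : islin Fi.
Proof. by move=> a x y; apply: (can_inj FK); rewrite FiK F_lin !FiK. Qed.

(** The inverse of T + B. As [G] and [B] are bounded, [T] is closed. *)
Let G := J \o (Fi \o J).
Let Glin : islin G. Proof. by move=> a x y; rewrite /G /= Jl Fi_lin Jl. Qed.
Let Gb : bounded_map (rp := rp) G. Proof. exact: bounded_comp Jb (bounded_comp Fib Jb). Qed.

Lemma sandwichP p : sandwich J Q p <-> p.1 = G (p.2 + B p.1).
Proof.
split=> [[u pu Qu]|e].
  rewrite pu /G /= (linD Jl) -Qu -FE FK //.
exists (Fi (J (p.2 + B p.1))) => //.
have := FE (Fi (J (p.2 + B p.1))); rewrite FiK -[J (Fi _)]e (linD Jl).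
by move=> /addIr.
Qed.

Lemma sandwich_op : operator_on (sandwich J Q).
Proof. by move=> y [u /= /esym/J0 -> ]; rewrite (lin0 Ql) => /esym/J0. Qed.

Lemma sandwich_closed : closed_rel (rp := rp) (sandwich J Q).
Proof.
move=> u p hu [h1 h2]; apply/sandwichP.
have [M hM] := Bb; have [M' hM'] := Gb.
have := tends_bounded Glin hM' (tendsD hV h2 (tends_bounded Bl hM h1)).
have -> : (fun n => G ((u n).2 + B (u n).1)) = (fun n => (u n).1).
  by apply/funext => n; have /sandwichP := hu n.
by move=> h; exact: (tends_uniq hV h1 h).
Qed.

(** D(T) = J Fi J V, so the coordinates [u] of its points [J u] fill Fi J V, which is dense since J
    V is dense and [Fi] is bounded and onto. Hence D(T) is a core of H. *)
Lemma range_core u : exists2 w : nat -> V, forall n, rel_dom (sandwich J Q) (J (w n)) &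
  tends nm w u.
Proof.
have [v vJ vF] := J_dense (F u); exists (Fi \o v).
  move=> n; have [x _ xv] := vJ n; exists (x - B (G x)); apply/sandwichP => /=.
  by rewrite -xv /= subrK.
have [M hM] := Fib; have := tends_bounded Fi_lin hM vF; rewrite FK //.
Qed.

Lemma sandwich_dom : orth_trivial (rp := rp) (rel_dom (sandwich J Q)).
Proof.
move=> x h; apply: J0; apply: (rp_eq0 hV) => y; have [w wd wy] := range_core y.
rewrite (siC hg); apply: cvg_seq_unique (tends_rp hV (y := J x) wy) _.
by under eq_fun do rewrite -Js (h _ (wd _)); exact: cvg_cst.
Qed.

Lemma sandwich_core x u : x = J u ->
  exists2 p : nat -> V * V, 
    forall n, (p n).1 = J (p n).2 /\ rel_dom (sandwich J Q) (p n).1 &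
    tends_pair (rp := rp) p (x, u).
Proof.
move=> ->; have [w wd wu] := range_core u; exists (fun n => (J (w n), w n)).
  by move=> n; split => //; exact: wd.
have [M hM] := Jb; split => //=; exact: (tends_bounded Jl hM wu).
Qed.

Section Comparison.
Variables (M : V -> V) (c : R).
Hypotheses (Ml : islin M) (Mb : bounded_map (rp := rp) M).
Hypotheses (Ms : symmetric_map (rp := rp) M) (Mc : coercive M).
Hypothesis Mdom : forall x, rel_dom (sandwich J M) x <-> rel_dom (sandwich J Q) x.
Hypothesis c0 : 0 <= c.
Hypothesis MQ : forall x y z, sandwich J Q (x, y) -> sandwich J M (x, z) ->
  nm z <= c * (nm x + nm y) /\ nm x + nm y <= c * nm z.

Let T := sandwich J Q.
Let K := sandwich J M.

(* The forms of [P], with [P^2 = T^* T], and of [K] are comparable, and so are the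
   latter and the graph norm of [H]. *)
Lemma root_form_domain P S : pos_selfadjoint (rp := rp) P ->
  rel_comp P P = rel_comp (radj (rp := rp) T) T ->
  pos_selfadjoint (rp := rp) S -> rel_comp S S = P -> rel_dom S = range J.
Proof.
move=> hP PT hS SP.
have Tl := sandwich_lin Ql; have Tc := sandwich_closed; have To := sandwich_op.
have Td := sandwich_dom.
have Pl := psa_lin hP; have Pcl := psa_closed hV hP; have Po := psa_op hV hP.
have Sl := psa_lin hS; have Scl := psa_closed hV hS; have So := psa_op hV hS.
have PT' : rel_comp (radj (rp := rp) P) P = rel_comp (radj (rp := rp) T) T.
  by rewrite psa_adj.
have TP x y : T (x, y) -> exists2 z, P (x, z) & nm z <= nm x + nm y.
  exact: (radj_comp_dom hV Tl Tc To Td Pl Pcl Po (esym PT')).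
have PTx x y : P (x, y) -> exists2 z, T (x, z) & nm z <= nm x + nm y.
  exact: (radj_comp_dom hV Pl Pcl Po (psa_dom hP) Tl Tc To PT').
have Kl := sandwich_lin Ml; have Ks := sandwich_sym Ms.
have Kpos : positive_rel (rp := rp) K.
  move=> [x z] [u /= -> Mu]; rewrite -Js -Mu; have [d d0 hd] := Mc.
  by apply: le_trans (hd u); rewrite mulr_ge0 ?(ltW d0) ?(si_ge0 hg).
have Kon := sandwich_onto (coercive_onto Ml Ms Mc).
(* A = P + 1: unlike P, it is onto. *)
pose A : set (V * V) := [set p | P (p.1, p.2 - p.1)].
have Al : linear_subspace A.
  split; first by rewrite /A /= subr0; exact: Pl.1.
  move=> a x y Ax Ay; rewrite /A /=.
  have : P (a *: x.1 + y.1, a *: (x.2 - x.1) + (y.2 - y.1)) := Pl.2 a _ _ Ax Ay.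
  by rewrite scalerBr addrACA -opprD.
have As : symmetric_rel (rp := rp) A.
  move=> p q Ap Aq; have := psa_sym hP Ap Aq; rewrite /= (siBl hg) (siBr hg); lra.
have Aform p : A p -> 0 <= rp p.2 p.1 - rp p.1 p.1.
  by move=> Ap; have := psa_pos hP Ap; rewrite /= (siBl hg).
have Apos : positive_rel (rp := rp) A.
  by move=> p /Aform; have := si_ge0 hg p.1; lra.
have Aon v : exists w, A (w, v).
  have [[x y] Pp /= <-] := pm_onto (psa_maximal hV hP) v.
  by exists x; rewrite /A /= addrC addKr.
have Ale p : A p -> nm p.1 <= nm p.2 /\ nm (p.2 - p.1) <= nm p.2.
  move=> /Aform; have := si_ge0 hg p.1; have := si_ge0 hg (p.2 - p.1).
  rewrite !(siE hg) (siC hg p.1 p.2) => h1 h2 h3.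
  by split; rewrite ler_sqrt ?(si_ge0 hg)// ?(siE hg) ?(siC hg p.1 p.2); lra.
have PK x : rel_dom P x <-> rel_dom K x.
  split=> [[y /PTx[z Tz _]]|/Mdom[y /TP[z Pz _]]]; last by exists z.
  by apply/Mdom; exists z.
(* The 3: with y = P x + x, both |x| and |P x| are at most |y|, so |x| + |T x| <= 2 |x| + |P x| <= 3
   |y|. *)
have upper x p z : P (x, p) -> K (x, z) -> rp z x <= (3 * c) * (rp p x + rp x x).
  move=> Px Kx; have Ax : A (x, p + x) by rewrite /A /= addrK.
  rewrite -(siDl hg); apply: (symmetric_dominated hV _ Al As Apos Aon Ks _ _ Ax Kx).
  - by rewrite mulr_ge0.
  - move=> {Px Kx Ax}x y Ax; apply/PK; by exists (y - x).
  - move=> {Px Kx Ax p z}x y z Ax Kx; have [t Tt ht] := PTx _ _ Ax.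
    have [/= h1 h2] := Ale _ Ax; have [h3 _] := MQ Tt Kx.
    rewrite /= in ht; have h4 : nm x + nm t <= 3 * nm y by lra.
    by have := ler_wpM2l c0 h4; lra.
(* Krein again with the roles exchanged: K is onto and dominates P. *)
have lower x p z : P (x, p) -> K (x, z) -> rp p x <= c * rp z x.
  move=> Px Kx; apply: (symmetric_dominated hV c0 Kl Ks Kpos Kon (psa_sym hP) _ _ Kx Px).
  - by move=> {Px Kx}x y Kx; apply/PK; exists y.
  - move=> {Px Kx p z}x z p Kx Px; have [t Tt _] := PTx _ _ Px.
    have [p' Pp' hp'] := TP _ _ Tt.
    have -> : p = p'.
      apply/eqP; rewrite -subr_eq0; apply/eqP; apply: Po.
      by have := subspaceB Pl Px Pp'; rewrite -[_ - _]/(x - x, p - p') subrr.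
    by apply: le_trans hp' _; exact: (MQ Tt Kx).2.
have [d d0 hd] := Mc.
(* The graph of H, the inverse of [J]. *)
pose HG : set (V * V) := [set q | q.1 = J q.2].
have HGl : linear_subspace HG.
  by split=> [|a x y hx hy]; rewrite /HG /= ?(lin0 Jl)// Jl hx hy.
have HGc : closed_rel (rp := rp) HG.
  move=> u p hu [h1 h2]; have [L hL] := Jb; apply: (tends_uniq hV h1).
  have -> : (fun n => (u n).1) = (fun n => J (u n).2) by apply/funext => n; exact: hu.
  exact: tends_bounded Jl hL h2.
have HGo : operator_on HG by move=> y /esym/J0.
have [k k0 hk] := bounded_pos Mb.
apply/seteqP; split=> x.
- move=> [s Sxs].
  (* On D(P), a core of S: d |H x|^2 <= <K x, x> <= 3 c (<P x, x> + |x|^2), and <P x, x> = |S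
     x|^2. *)
  pose C := Num.sqrt (d^-1 * (3 * c)).
  have [] := core_transfer hV (C := C)
    (G0 := [set q | S q /\ exists w, radj (rp := rp) S (q.2, w)])
    (G1 := S) _ HGl HGc HGo _ _ Sxs.
  + split; first by split; [exact: Sl.1|exists 0; exact: (radj_lin hV Sl).1].
    move=> a p q [Sp [w Aw]] [Sq [w' Aw']]; split; first exact: Sl.2.
    by exists (a *: w + w'); exact: ((radj_lin hV Sl).2 a _ _ Aw Aw').
  + move=> {Sxs s}x s [Sxs [w]]; rewrite psa_adj// => Ssw.
    have Pxw : P (x, w) by rewrite -SP; exists s.
    have [z Kxz] : rel_dom K x by apply/PK; exists w.
    have [u xu _] := Kxz; exists u => //.
    have C0 : 0 <= C := sqrtr_ge0 _.
    rewrite (sinorm_sqrle hg) ?mulr_ge0 ?addr_ge0 ?sinorm_ge0//.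
    rewrite exprMn sqr_sqrtr ?mulr_ge0 ?invr_ge0 ?(ltW d0)// -mulrA ler_pdivlMl//.
    apply: le_trans (hd u) _; rewrite -(sandwich_form Kxz xu).
    apply: le_trans (upper _ _ _ Pxw Kxz) _; rewrite ler_wpM2l ?mulr_ge0//.
    have := psa_sym hS Sxs Ssw; rewrite /= (siC hg x w) => <-.
    rewrite -!(sinormE hg); have := sinorm_ge0 (g:=rp) x; have := sinorm_ge0 (g:=rp) s.
    nra.
  + by move=> p Sp; apply: (radj_comp_core hV) => //; exact: psa_dom.
  + by move=> u xu _; exists u.
- move=> [u _ xu].
  (* On D(T), a core of H: |S x|^2 = <P x, x> <= c <K x, x> <= c k |H x|^2. *)
  pose C := Num.sqrt (c * k).
  have [] := core_transfer hV (C := C) (G0 := [set q | HG q /\ rel_dom T q.1])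
    (G1 := HG) _ Sl Scl So _ _ (esym xu : HG (x, u)).
  + split; first by split; [exact: HGl.1|exists 0; exact: Tl.1].
    move=> a p q [Hp [w Aw]] [Hq [w' Aw']]; split; first exact: HGl.2.
    by exists (a *: w + w'); exact: (Tl.2 a _ _ Aw Aw').
  + move=> {xu u}x u [xu /= xT]; have xK : rel_dom K x by apply/Mdom.
    have /PK[p Px] := xK; have [z Kx] := xK.
    have [s Sxs Ssp] : rel_comp S S (x, p) by rewrite SP.
    exists s => //; have C0 : 0 <= C := sqrtr_ge0 _.
    rewrite (sinorm_sqrle hg) ?mulr_ge0 ?addr_ge0 ?sinorm_ge0//.
    rewrite exprMn sqr_sqrtr ?mulr_ge0 ?(ltW k0)//.
    have -> : rp s s = rp p x.
      by have := psa_sym hS Sxs Ssp; rewrite /= (siC hg x p).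
    apply: le_trans (lower _ _ _ Px Kx) _; rewrite -mulrA ler_wpM2l//.
    rewrite (sandwich_form Kx xu); apply: le_trans (si_ler hg _ _) _.
    have := hk u; have := sinorm_ge0 (g:=rp) u; have := sinorm_ge0 (g:=rp) x.
    move: (nm x) (nm u) (nm (M u)) => a b e ha hb he.
    apply: (@le_trans _ _ (k * (b * b))); first by rewrite mulrA ler_wpM2r.
    rewrite ler_wpM2l ?(ltW k0)//; nra.
  + move=> [y v] yv; have [p hp pt] := sandwich_core yv.
    by exists p.
  + by move=> s Sxs _; exists s.
Qed.

End Comparison.
End Perturbed.
End Sandwich.
End FormDomain.

(** * The choice of M in the three cases *)

Section Cases.
Context {R : realType} {V : lmodType R[i]} {rp : V -> V -> R}.
Hypothesis hV : real_hilbert rp.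
Local Notation nm := (sinorm rp).
Let hg : semi_inner rp := rh_si hV.
Implicit Types (x y z u v w : V) (P S T K : set (V * V)).

Lemma closed_graph_nm (f : V -> V) (Y : set V) : islin f ->
  (forall x, exists2 u : nat -> V, forall n, Y (u n) & tends nm u x) ->
  (forall y, Y y -> exists M : R, forall x, `|rp (f x) y| <= M * nm x) ->
  bounded_map (rp := rp) f.
Proof.
move=> fl Yd fY.
have [C _ hC] := closed_graph_bounded hV (@sinorm_ge0 _ _ rp) (sinormD hg)
  (sinormZ hg) (rh_complete hV) fl Yd fY.
by exists C.
Qed.

(** [Y] is the range of the adjoint f^*, dense because [f] is injective; for y = f^* z the
    functional <g x, y> = <x, z> is bounded. *)
Lemma inverse_bounded (f g : V -> V) : islin f -> bounded_map (rp := rp) f ->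
  cancel f g -> cancel g f -> bounded_map (rp := rp) g.
Proof.
move=> fl [M hM] fK gK.
have gl : islin g by move=> a x y; apply: (can_inj fK); rewrite gK fl !gK.
pose Y := [set y | exists z, forall x, rp (f x) z = rp x y].
apply: (closed_graph_nm (Y := Y) gl) => [|y [z hz]]; last first.
  exists (nm z) => x; rewrite -hz gK mulrC; exact: (si_le hg).
apply: (orth_dense hV) => [|x h].
  split; first by exists 0 => x; rewrite !(si0r hg).
  move=> a y y' [z hz] [z' hz']; exists (a *: z + z') => x.
  rewrite !(siDr hg) hz'; congr (_ + _).
  by rewrite -[a]conjCK -!(rp_conj hV) -(linZ fl) hz.
rewrite -[x]fK; suff -> : f x = 0 by rewrite (lin0 gl).
apply: (rp_eq0 hV) => z.
have [|||y _|u [_ cu hu]] :=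
  riesz_sequence (D := setT) (L := fun y => rp (f y) z) (M := M * nm z) hg.
- by split.
- by move=> y y' _ _; rewrite (linD fl) (siDl hg).
- by move=> a y _; rewrite (linZ fl) (siZ hg).
- apply: le_trans (si_ler hg _ _) _; rewrite mulrAC ler_wpM2r ?sinorm_ge0//.
have [y uy] := rh_complete hV cu.
have E a : rp (f a) z = rp a y := cvg_seq_unique (hu a I) (tends_rpr hV uy).
by rewrite E (siC hg) h//; exists z.
Qed.

Lemma tends_rp2 (u v : nat -> V) x y : tends nm u x -> tends nm v y ->
  (fun n => rp (u n) (v n)) @ \oo --> rp x y.
Proof.
move=> ux vy; apply/subr_cvg0; apply/norm_cvg0P.
apply: (squeeze_cvgr _ (cvg_cst 0)
   (h := fun n => nm (u n - x) * nm (v n) + nm (v n - y) * nm x)).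
  near=> n; rewrite normr_ge0/=.
  have -> : rp (u n) (v n) - rp x y = rp (u n - x) (v n) + rp (v n - y) x.
    by rewrite !(siE hg) (siC hg x (v n)) (siC hg x y); lra.
  by apply: le_trans (ler_normD _ _) _; rewrite lerD// (si_le hg).
have h : (fun n => nm (u n - x) * nm (v n) + nm (v n - y) * nm x) @ \oo -->
    0 * nm y + 0 * nm x.
  by apply: cvgD; [apply: cvgM => //; exact: (tends_nm hV)|exact: cvgMl].
by rewrite !mul0r addr0 in h.
Unshelve. all: by end_near. Qed.

(** The hypothesis says that <f u, u> is real. Polarize it, then replace the second vector by its
    multiple by 'i. *)
Lemma symmetric_of_real (f : V -> V) : islin f ->
  (forall u, rp ('i *: f u) u = 0) -> symmetric_map (rp := rp) f.
Proof.
move=> fl h x y.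
have E u v : rp ('i *: f u) v + rp ('i *: f v) u = 0.
  have := h (u + v); rewrite (linD fl) scalerDr !(siE hg) !h; lra.
have := E x ('i *: y); rewrite (rh_i hV) (linZ fl) scalerA -expr2 sqr_i scaleN1r.
by rewrite (siNl hg) (siC hg x); lra.
Qed.

Section Setting.
Variables J Q B F : V -> V.
Hypotheses (Jl : islin J) (Jb : bounded_map (rp := rp) J) (Js : symmetric_map (rp := rp) J).
Hypothesis J0 : forall u, J u = 0 -> u = 0.
Hypotheses (Ql : islin Q) (Qb : bounded_map (rp := rp) Q).
Hypotheses (Bl : islin B) (Bb : bounded_map (rp := rp) B).
Hypothesis FE : forall u, F u = Q u + J (B (J u)).
Hypotheses (F0 : forall u, F u = 0 -> u = 0) (Fo : forall v, exists u, F u = v).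

Let T := sandwich J Q.
Let Fl : islin F := F_lin Jl Ql Bl FE.

Lemma F_bounded : bounded_map (rp := rp) F.
Proof.
have [q hq] := Qb; have [m hm] := bounded_comp Jb (bounded_comp Bb Jb).
exists (q + m) => x; rewrite FE mulrDl; apply: le_trans (sinormD hg _ _) _.
exact: lerD (hq x) (hm x).
Qed.

Let Fb := F_bounded.

Let Finv : {Fi : V -> V | cancel F Fi /\ cancel Fi F}.
Proof.
apply: cid; have [Fi FiK] := choice Fo; exists Fi; split => // x.
apply/eqP; rewrite -subr_eq0; apply/eqP; apply: F0.
by rewrite (linB Fl) FiK subrr.
Qed.
Let Fi := sval Finv.
Let FK : cancel F Fi := (svalP Finv).1.
Let FiK : cancel Fi F := (svalP Finv).2.
Let Fib : bounded_map (rp := rp) Fi := inverse_bounded Fl Fb FK FiK.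

Lemma sandwichF x y u : T (x, y) -> x = J u -> F u = J (y + B x).
Proof. by move=> [v /= -> Qv] /(J_inj Jl J0) <-; rewrite FE Qv (linD Jl). Qed.

Lemma sandwichF_dom u y : F u = J y -> T (J u, y - B (J u)).
Proof. by move=> e; exists u => //=; rewrite (linB Jl) -e FE addrK. Qed.

Variables P S : set (V * V).
Hypotheses (hP : pos_selfadjoint (rp := rp) P).
Hypothesis PT : rel_comp P P = rel_comp (radj (rp := rp) T) T.
Hypotheses (hS : pos_selfadjoint (rp := rp) S) (SP : rel_comp S S = P).

(** Here M = 1 and K = H^2. With [W] = H F J and its inverse [W'] = H F^-1 J, both everywhere
    defined, T + B = W K on D(T), so boundedness of the two gives the comparison. *)
Lemma root_dom_stable :
  (forall u, exists v, F (J u) = J v) -> (forall v, exists u, F (J u) = J v) ->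
  rel_dom S = range J.
Proof.
move=> FJ JF.
have [W hW] := choice FJ; have [W' hW'] := choice JF.
have Wl : islin W.
  by move=> a x y; apply: (J_inj Jl J0); rewrite -hW !Jl Fl -!hW.
have W'l : islin W'.
  by move=> a x y; apply: (J_inj Jl J0); apply: (can_inj FK); rewrite hW' !Jl Fl !hW'.
(* Against the dense range of [J]: <W x, J a> = <F J x, a>. *)
have Wb : bounded_map (rp := rp) W.
  apply: (closed_graph_nm Wl (J_dense hV Jl Js J0)) => _ [a _ <-].
  have [m hm] := bounded_comp Fb Jb; exists (m * nm a) => x.
  rewrite -Js -hW; apply: le_trans (si_le hg _ _) _.
  by rewrite mulrAC ler_wpM2r ?sinorm_ge0//; exact: hm.
have W'b : bounded_map (rp := rp) W'.
  apply: (closed_graph_nm W'l (J_dense hV Jl Js J0)) => _ [a _ <-].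
  have [m hm] := bounded_comp Fib Jb; exists (m * nm a) => x.
  rewrite -Js -[J (W' x)]FK hW'.
  apply: le_trans (si_le hg _ _) _.
  by rewrite mulrAC ler_wpM2r ?sinorm_ge0//; exact: hm.
have [w w0 hw] := bounded_pos Wb; have [w' w'0 hw'] := bounded_pos W'b.
have [b b0 hb] := bounded_pos Bb; have [j j0 hj] := bounded_pos (bounded_comp Jb Jb).
(* Collects |T x| <= w |K x| + b |x|, |K x| <= w' (|T x| + b |x|) and |x| <= j |K x|. *)
pose c := w' + w' * b + w + b * j + j.
apply: (root_form_domain hV Jl Jb Js J0 Ql Bl Bb FE FK FiK Fib
  (M := id) (c := c) _ _ _ _ _ _ _ hP PT hS SP) => //.
- by exists 1 => x; rewrite mul1r.
- by exists 1 => // u; rewrite mul1r.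
- move=> x; split => [[z [u /= -> ->]]|[y Ty]].
    have [v Fv] := FJ z; exists (v - B (J (J z))); exact: sandwichF_dom.
  have [u /= xu Qu] := Ty; have Fu := sandwichF Ty xu.
  have [a Fa] := JF (y + B x); exists a; exists u => //=.
  by apply: (can_inj FK); rewrite Fu Fa.
- by rewrite /c !addr_ge0 ?mulr_ge0 ?ltW.
- move=> x y z Txy [u /= xu uz]; have Fu := sandwichF Txy xu.
  have yz : y = W z - B x.
    by rewrite (_ : W z = y + B x) ?addrK//; apply: (J_inj Jl J0); rewrite -Fu -hW uz.
  have zy : z = W' (y + B x).
    by apply: (J_inj Jl J0); apply: (can_inj FK); rewrite hW' -Fu uz.
  have h1 : nm y <= w * nm z + b * nm x.
    by rewrite {1}yz; apply: le_trans (sinormB hg _ _) _; rewrite lerD.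
  have h2 : nm z <= w' * (nm y + b * nm x).
    rewrite {1}zy; apply: le_trans (hw' _) _; rewrite ler_wpM2l ?(ltW w'0)//.
    by apply: le_trans (sinormD hg _ _) _; rewrite lerD2l.
  have h3 : nm x <= j * nm z by rewrite xu uz; exact: hj.
  have := sinorm_ge0 (g:=rp) x; have := sinorm_ge0 (g:=rp) y; have := sinorm_ge0 (g:=rp) z.
  move: h1 h2 h3; rewrite /c; move: (nm x) (nm y) (nm z) => X Y Z h1 h2 h3 Z0 Y0 X0.
  have w'b : 0 <= w' * b by rewrite mulr_ge0 ?ltW.
  have bj : 0 <= b * j by rewrite mulr_ge0 ?ltW.
  split; first nra.
  have := ler_wpM2l (ltW b0) h3; have := ltW w0; have := ltW j0; have := ltW w'0; nra.
Qed.

(** The form condition extends from D(T) to all [u] by [range_core], as [F] and [J] are bounded; in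
    particular [F] is symmetric. Here K = T + B + c on D(T). *)
Lemma root_dom_semibounded (gamma : R) :
  (forall u, rel_dom T (J u) ->
     rp ('i *: F u) u = 0 /\ gamma * rp (J u) (J u) <= rp (F u) u) ->
  rel_dom S = range J.
Proof.
move=> hF0.
have [f f0 hf] := bounded_pos Fb; have [j j0 hj] := bounded_pos Jb.
have hF u : rp ('i *: F u) u = 0 /\ gamma * rp (J u) (J u) <= rp (F u) u.
  have [w wd wu] := range_core hV Jl Js J0 Ql Bl FE FK FiK Fib u.
  have Fw := tends_bounded Fl hf wu; have Jw := tends_bounded Jl hj wu.
  split.
    apply: cvg_seq_unique (tends_rp2 (tendsZ hV 'i Fw) wu) _.
    by under eq_fun do rewrite (hF0 _ (wd _)).1; exact: cvg_cst.
  apply: (ler_cvg_to _ (tends_rp2 Fw wu)).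
    by apply: cvgMr; exact: (tends_rp2 Jw Jw).
  by apply: nearW => n; exact: (hF0 _ (wd n)).2.
have Fs := symmetric_of_real Fl (fun u => (hF u).1).
(* c + gamma >= 1 yields <M u, u> >= |J u|^2, that is K >= 1. *)
have [c c0 cg] : exists2 c : R, 0 < c & 1 - gamma <= c.
  exists (`|gamma| + 1); first by rewrite ltr_wpDl.
  by have := ler_norm (- gamma); rewrite normrN; lra.
pose M u := F u + real_complex R c *: J (J u).
have Ml : islin M.
  move=> a x y; rewrite /M Fl !Jl scalerDr scalerA mulrC -scalerA scalerDr.
  by rewrite addrACA.
have Ms : symmetric_map (rp := rp) M.
  by move=> x y; rewrite /M !(siE hg) Fs !Js.
have Mb : bounded_map (rp := rp) M.
  have [k k0 hk] := bounded_pos (bounded_comp Jb Jb); exists (f + c * k) => x.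
  apply: le_trans (sinormD hg _ _) _; rewrite (sinormZ hg) gtr0_norm// mulrDl.
  apply: lerD (hf x) _; rewrite -mulrA ler_wpM2l ?(ltW c0)//; exact: hk.
have MJ u : rp (J u) (J u) <= rp (M u) u.
  rewrite /M !(siE hg) (Js (J u) u); have := (hF u).2; have := si_ge0 hg (J u); nra.
have [m m0 hm] := bounded_pos Mb; have [fi fi0 hfi] := bounded_pos Fib.
have [b b0 hb] := bounded_pos Bb.
have Mform u : 0 <= rp (M u) u := le_trans (si_ge0 hg _) (MJ u).
have Mcoer : coercive (rp := rp) M.
  (* Cauchy-Schwarz for the nonnegative form of M, applied to u and M u. *)
  have MM u : rp (M u) (M u) <= m * rp (M u) u.
    have MS : semi_inner (fun u v => rp (M u) v).
      split=> [x y z|x y|a x y|x] //.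
      - by rewrite (linD Ml) (siDl hg).
      - by rewrite Ms (siC hg).
      - by rewrite (linZ Ml) (siZ hg).
    have := si_CS MS u (M u) => /=.
    have h1 : rp (M (M u)) (M u) <= m * rp (M u) (M u).
      apply: le_trans (si_ler hg _ _) _; rewrite -(sinormE hg) expr2 mulrA.
      by rewrite ler_wpM2r ?sinorm_ge0.
    have := ler_wpM2l (Mform u) h1; have := si_ge0 hg (M u).
    have := Mform u; move: (rp (M u) (M u)) (rp (M u) u) (rp (M (M u)) _) => a e g.
    have [->|a0] := eqVneq a 0; first by move=> e0 *; rewrite mulr_ge0 ?(ltW m0).
    move=> e0 age0 h2 h3; have ap : 0 < a by rewrite lt_neqAle eq_sym a0.
    rewrite -(ler_pM2l ap) -expr2; apply: le_trans h3 _; apply: le_trans h2 _.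
    by rewrite mulrCA [a * _]mulrCA [e * a]mulrC.
  (* From F = M - c J^2: |u|^2 <= fi^2 |F u|^2 <= fi^2 (2 |M u|^2 + 2 (c j)^2 |J u|^2), and both
     squares are controlled by <M u, u>. *)
  pose D := fi ^+ 2 * (2 * m + 2 * (c * j) ^+ 2).
  have D0 : 0 < D.
    by rewrite mulr_gt0 ?exprn_gt0// ltr_wpDr ?mulr_gt0// mulr_ge0 ?sqr_ge0.
  exists D^-1; first by rewrite invr_gt0.
  move=> u; rewrite mulrC ler_pdivrMr// -(sinormE hg).
  have h1 : nm u <= fi * nm (F u) by rewrite -{1}(FK u).
  have h2 : nm (F u) <= nm (M u) + c * j * nm (J u).
    rewrite -[F u](addrK (real_complex R c *: J (J u))) -/(M u).
    apply: le_trans (sinormB hg _ _) _; rewrite lerD2l (sinormZ hg) gtr0_norm//.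
    by rewrite -mulrA ler_wpM2l ?(ltW c0).
  have h3 : nm (F u) ^+ 2 <= (2 * m + 2 * (c * j) ^+ 2) * rp (M u) u.
    have := MM u; have := MJ u; rewrite -!(sinormE hg) => h4 h5.
    have h6 := ler_wpM2l (sqr_ge0 (c * j)) h4.
    have F_0 := sinorm_ge0 (g:=rp) (F u).
    have h7 : nm (F u) ^+ 2 <= (nm (M u) + c * j * nm (J u)) ^+ 2.
      by rewrite ler_sqr ?nnegrE//; apply: le_trans h2.
    apply: le_trans h7 _.
    have := sqr_ge0 (nm (M u) - c * j * nm (J u)).
    rewrite sqrrB sqrrD exprMn; lra.
  have h8 : nm u ^+ 2 <= fi ^+ 2 * nm (F u) ^+ 2.
    by rewrite -exprMn ler_sqr ?nnegrE ?mulr_ge0 ?sinorm_ge0// ltW.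
  by have := ler_wpM2l (sqr_ge0 fi) h3; rewrite /D; lra.
pose e := 1 + b + c + 1 + b + c.
apply: (root_form_domain hV Jl Jb Js J0 Ql Bl Bb FE FK FiK Fib
  (M := M) (c := e) Ml Mb Ms Mcoer _ _ _ hP PT hS SP).
- move=> x; split => [[z [u /= xu Mu]]|[y Ty]].
    have Fu : F u = J (z - real_complex R c *: J u).
      by rewrite (linB Jl) (linZ Jl) -Mu /M addrK.
    by rewrite xu; eexists; exact: sandwichF_dom Fu.
  have [u /= xu Qu] := Ty; have Fu := sandwichF Ty xu.
  exists (y + B x + real_complex R c *: x); exists u => //=.
  by rewrite /M Fu xu [RHS](linD Jl) (linZ Jl).
- by rewrite /e !addr_ge0 ?ltW.
- move=> x y z Txy [u /= xu Mu]; have Fu := sandwichF Txy xu.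
  have ze : z = y + (B x + real_complex R c *: x).
    apply: (J_inj Jl J0); rewrite -Mu /M Fu xu addrA.
    by rewrite [RHS](linD Jl) (linZ Jl).
  have h1 : nm (B x + real_complex R c *: x) <= (b + c) * nm x.
    apply: le_trans (sinormD hg _ _) _; rewrite (sinormZ hg) gtr0_norm// mulrDl.
    by rewrite lerD2r.
  have h2 : nm z <= nm y + (b + c) * nm x.
    by rewrite ze; apply: le_trans (sinormD hg _ _) _; rewrite lerD2l.
  have h3 : nm y <= nm z + (b + c) * nm x.
    have -> : y = z - (B x + real_complex R c *: x) by rewrite ze addrK.
    by apply: le_trans (sinormB hg _ _) _; rewrite lerD2l.
  (* K >= 1 gives |x|^2 <= <K x, x> <= |K x| |x|. *)
  have h4 : nm x <= nm z.
    have := MJ u; rewrite -xu Mu Js -xu => h; have := si_ler hg z x.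
    move=> /(le_trans h); rewrite -(sinormE hg) expr2.
    have [->|x0] := eqVneq (nm x) 0; first by rewrite sinorm_ge0.
    by rewrite ler_pM2r// lt_neqAle eq_sym x0 sinorm_ge0.
  have := sinorm_ge0 (g:=rp) x; have := sinorm_ge0 (g:=rp) y; have := sinorm_ge0 (g:=rp) z.
  move: h2 h3 h4; rewrite /e; move: (nm x) (nm y) (nm z) => X Y Z h2 h3 h4 Z0 Y0 X0.
  have bc : 0 <= b + c by rewrite addr_ge0 ?ltW.
  split; nra.
Qed.

End Setting.
End Cases.

(** * From the complex inner product to its real part *)

Section Bridge.
Context {R : realType} {V : completeNormedModType R[i]} {ip : {dot V for Num.conj}}.
Hypothesis hip : hilbert_inner_product ip.
Implicit Types (x y z u v w : V) (A P S T : set (V * V)).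

Definition re_inner x y : R := complex.Re (ip x y).
Local Notation rp := re_inner.
Local Notation nm := (sinorm rp).

Lemma Re_mulR (a : R) (z : R[i]) :
  complex.Re (real_complex R a * z) = a * complex.Re z.
Proof. by case: z => x y /=; rewrite mul0r subr0. Qed.

Lemma ge0_RRe (z : R[i]) : 0 <= z -> z = real_complex R (complex.Re z).
Proof. by move=> z0; rewrite (RRe_real (ger0_real z0)). Qed.

Lemma ipC x y : ip x y = (ip y x)^*.
Proof. by rewrite hermC expr0 mul1r. Qed.

Lemma re_inner_semi : semi_inner rp.
Proof.
split=> [x y z|x y|a x y|x]; rewrite /re_inner.
- by rewrite linearDl raddfD.
- by rewrite ipC; case: (ip y x).
- by rewrite linearZl_LR Re_mulR.
- by have : 0 <= ip x x; [rewrite hip exprn_ge0|rewrite lecE => /andP[]].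
Qed.
Let hg := re_inner_semi.

Lemma norm_re x : `|x| = real_complex R (nm x).
Proof.
rewrite [LHS]ge0_RRe//; congr (real_complex R _).
rewrite /sinorm /re_inner hip [`|x|]ge0_RRe// -rmorphXn/= sqrtr_sqr ger0_norm//.
by have : 0 <= `|x| by []; rewrite lecE => /andP[].
Qed.

Lemma re_inner_hilbert : real_hilbert rp.
Proof.
split; first exact: hg.
- by move=> x h; apply/eqP; rewrite -normr_eq0 norm_re /sinorm h sqrtr0.
- move=> x y; rewrite /re_inner linearZl_LR linearZr_LR /=.
  by rewrite mulrA -normCK normCi expr1n mul1r.
- move=> u cu.
  have : cvg (u @ \oo).
    apply/cauchy_cvgP/cauchy_exP => e e0.
    have e1 : 0 < complex.Re e by move: e0; rewrite ltcE => /andP[].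
    have [n0 hn] := cu _ e1; exists (u n0), n0 => // n /= n0n.
    rewrite -ball_normE /ball_ /= norm_re [e]ge0_RRe ?(ltW e0)// ltcR.
    exact: hn.
  move=> /cvg_ex[l ul]; exists l; apply/tendsP => [x|e e0]; first exact: sinorm_ge0.
  have e1 : 0 < real_complex R e by rewrite ltcR.
  have /cvgrPdist_lt/(_ _ e1)[n0 _ hn] := ul.
  by exists n0 => n /hn /=; rewrite norm_re ltcR (sinormC hg).
Qed.
Let hV := re_inner_hilbert.

Lemma ip_eq x y z w : (forall a : R[i], rp (a *: x) y = rp (a *: z) w) -> ip x y = ip z w.
Proof.
move=> h; have := h 1; have := h 'i; rewrite !scale1r /re_inner !linearZl_LR /=.
rewrite -complexiE; case: (ip x y) => a b; case: (ip z w) => c d /=.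
by rewrite !mul0r !mul1r !sub0r => /oppr_inj -> ->.
Qed.

Lemma ip_nondeg x y : (forall z, ip x z = ip y z) -> x = y.
Proof.
move=> h; apply/eqP; rewrite -subr_eq0; apply/eqP; apply: (rp_eq0 hV) => z.
by rewrite (siBl hg) /re_inner h subrr.
Qed.

Lemma Im_ip x y : rp ('i *: x) y = - complex.Im (ip x y).
Proof. by rewrite /re_inner linearZl_LR /= -complexiE mulrC ReiNIm. Qed.

Lemma ip_ge0 x y : (0 <= ip x y) <-> rp ('i *: x) y = 0 /\ 0 <= rp x y.
Proof.
rewrite Im_ip /re_inner lecE /=; split=> [/andP[/eqP -> ->]|[/eqP]]; rewrite ?oppr0//.
by rewrite oppr_eq0 => /eqP -> ->; rewrite eqxx.
Qed.

Lemma radj_adjoint A : linear_subspace A -> radj (rp := rp) A = op_adjoint ip A.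
Proof.
move=> Al; apply/seteqP; split => [[x z] h u w Auw|[x z] h u w Auw] /=; last first.
  by rewrite /re_inner (h _ _ Auw).
by apply: ip_eq => a; exact: h (subspaceZ Al a Auw).
Qed.

Lemma pos_selfadjointP P : pos_selfadjoint (rp := rp) P <->
  self_adjoint ip P /\ op_positive ip P.
Proof.
split=> [hP|[[[Pl PU] Pd Pa] Pp]].
  have Pl := psa_lin hP; split; last first.
    move=> x y Pxy; apply/ip_ge0; split; last exact: (psa_pos hP Pxy).
    (* Symmetry tested on p against its multiple by 'i makes <y, x> real. *)
    have Pi := subspaceZ Pl 'i Pxy; have := psa_sym hP Pxy Pi.
    by rewrite /= (siC hg x) (rp_il hV); lra.
  split; last by rewrite -radj_adjoint ?psa_adj.
    split => // x y y' Pxy Pxy'; apply/eqP; rewrite -subr_eq0; apply/eqP.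
    apply: (psa_op hV hP); rewrite -(subrr x); exact: (subspaceB Pl Pxy Pxy').
  move=> O [x Ox] oO.
  have Dl : linear_subspace (rel_dom P).
    split; first by exists 0; exact: Pl.1.
    by move=> a y z [y' Py] [z' Pz]; exists (a *: y' + z'); exact: (Pl.2 a _ _ Py Pz).
  have [u uP ux] := orth_dense hV Dl (psa_dom hP) x.
  have [e /= e0 he] := (nbhs_ballP _ _).1 (open_nbhs_nbhs (conj oO Ox)).
  have e1 : 0 < complex.Re e by move: e0; rewrite ltcE => /andP[].
  have /tendsP/(_ _ e1)[|n0 hn0] := ux; first by move=> ?; exact: sinorm_ge0.
  exists (u n0); split; last exact: uP.
  apply: he; rewrite -ball_normE /ball_ /= norm_re [e]ge0_RRe ?(ltW e0)// ltcR.
  by rewrite (sinormC hg); exact: hn0.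
have Pa' : radj (rp := rp) P = P by rewrite radj_adjoint.
split => //; last by move=> [x y] /Pp/ip_ge0[].
(* A vector x orthogonal to the domain gives (0, x) in the adjoint, which is P. *)
move=> x h; apply: (PU 0) Pl.1; rewrite -Pa' => y z Pyz.
by rewrite (si0r hg) h//; exists z.
Qed.

(** The existence of a root keeps [xget] from returning [set0]. *)
Lemma op_sqrtP A : pos_maximal (rp := rp) A ->
  pos_selfadjoint (rp := rp) (op_sqrt ip A) /\ rel_comp (op_sqrt ip A) (op_sqrt ip A) = A.
Proof.
move=> /(pos_maximal_root hV)[P /pos_selfadjointP[P1 P2] P3].
have [] : [set S | [/\ self_adjoint ip S, op_positive ip S & op_comp S S = A]] (op_sqrt ip A).
  by apply: xgetPex; exists P.
by move=> h1 h2 h3; split => //; apply/pos_selfadjointP.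
Qed.

(** [P] and [S] are arbitrary because [op_sqrt] chooses an unspecified root. *)
Lemma op_sqrt_abs_dom T (X : set V) : linear_subspace T -> closed_rel (rp := rp) T ->
  operator_on T -> orth_trivial (rp := rp) (rel_dom T) ->
  (forall P S, pos_selfadjoint (rp := rp) P -> rel_comp P P = rel_comp (radj (rp := rp) T) T ->
     pos_selfadjoint (rp := rp) S -> rel_comp S S = P -> rel_dom S = X) ->
  op_dom (op_sqrt ip (op_abs ip T)) = X.
Proof.
move=> Tl Tc To Td h; have := radj_comp_maximal hV Tl Tc To Td.
rewrite /op_abs; rewrite radj_adjoint// => /op_sqrtP[hP PT].
have [hS SP] := op_sqrtP (psa_maximal hV hP).
by apply: h hP _ hS SP; rewrite radj_adjoint.
Qed.

Lemma bounded_op_map (f : {linear V -> V}) : bounded_op f -> bounded_map (rp := rp) f.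
Proof.
move=> [M hM]; exists (complex.Re M) => x; have := hM x.
rewrite !norm_re lecE => /andP[_]; rewrite [M * _]mulrC Re_mulR mulrC //.
Qed.

Lemma linear_islin (f : {linear V -> V}) : islin f.
Proof. by move=> a x y; rewrite linearP. Qed.

Lemma normr_real_complex (a : R) : `|real_complex R a| = real_complex R `|a|.
Proof. by rewrite normc_def /= expr0n addr0 sqrtr_sqr. Qed.

(** The factor 2 comes from |z| <= |Re z| + |Im z|. *)
Lemma norm_ip_le x y : `|ip x y| <= real_complex R (2 * (nm x * nm y)).
Proof.
rewrite [ip x y]complexE (le_trans (ler_normD _ _))// normrM complexiE normCi mul1r.
rewrite !normr_real_complex -rmorphD/= lecR mulr_natl mulr2n lerD//.
  exact: (si_le hg).
rewrite -normrN -Im_ip; apply: le_trans (si_le hg _ _) _.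
by rewrite /sinorm (rh_i hV).
Qed.

End Bridge.

Theorem lemma4p13 (R : realType) (V : completeNormedModType R[i])
    (ip : {dot V for Num.conj}) (hip : hilbert_inner_product ip)
    (D : set V) (hD : linear_subspace D) (hDdense : dense D)
    (Omega : V -> V -> R[i]) (hOmega : sesquilinear_on D Omega)
    (N : V -> R[i]) (hN : hilbert_norm D N) (hsolv : solvable D Omega N)
    (T : set (V * V)) (hT : T = form_operator ip D Omega)
    (Q : {linear V -> V}) (H : set (V * V))
    (hRN : radon_nikodym_like ip D Omega Q H)
    (Upsilon : V -> V -> R[i]) (hUpsilon : perturbations D Omega N Upsilon)
    (B : {linear V -> V}) (hBbounded : bounded_op B)
    (hB : forall x y : V, Upsilon x y = ip (B x) y)
    (QB : set (V * V)) (hQB : QB = op_QB Q B H) :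
  op_image QB D = D \/ op_positive ip QB \/
    op_semibounded ip (op_add T (op_graph B)) ->
  hyper_solvable ip D Omega.
Proof.
move=> hyp; split; first by exists N.
have hg := re_inner_semi hip; have hV := re_inner_hilbert hip.
have [Qbnd [[[Hl HU] _ Ha] _] [HD [J0' J0'b HJ]] OQ] := hRN.
pose J : V -> V := J0'.
have HE x y : H (x, y) <-> x = J y.
  have := congr1 (fun E : set (V * V) => E (y, x)) HJ.
  by rewrite /op_inv /op_shift /op_graph /= scale0r addr0 => ->.
have Jl : islin J := linear_islin J0'.
have Jb := bounded_op_map hip J0'b.
have HJu u : H (J u, u) by apply/HE.
have Jsc u v : ip (J u) v = ip u (J v).
  by have := HJu v; rewrite -Ha => /(_ _ _ (HJu u)) /=.
have Js : symmetric_map (rp := re_inner (ip := ip)) J.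
  by move=> u v; rewrite /re_inner Jsc.
have J0 u : J u = 0 -> u = 0.
  by move=> Ju; apply: (HU 0); [apply/HE|exact: Hl.1].
have DE x : D x <-> exists u, x = J u.
  by rewrite -HD; split=> [[u /HE ->]|[u ->]]; exists u.
have Bb := bounded_op_map hip hBbounded; have Qb := bounded_op_map hip Qbnd.
have Bl := linear_islin B; have Ql := linear_islin Q.
(* At x = J u the form is Omega(J u, J v) = <Q u, v>, while <y, J v> = <J y, v>. *)
have TE : T = sandwich J Q.
  rewrite hT; apply/seteqP; split=> [[x y] [/= /DE[u ->] h]|[x y] [u /= -> Qu]].
    exists u => //=; apply: (ip_nondeg hip) => v; 
    rewrite Jsc -h; last by apply/DE; exists v.
    exact: esym (OQ _ _ _ _ (HJu u) (HJu v)).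
  split=> /=; first by apply/DE; exists u.
  by move=> _ /DE[v ->]; rewrite (OQ _ _ _ _ (HJu u) (HJu v)) Qu Jsc.
pose F u := Q u + J (B (J u)).
have FE u : F u = Q u + J (B (J u)) by [].
have OF u v : Omega (J u) (J v) + Upsilon (J u) (J v) = ip (F u) v.
  by rewrite (OQ _ _ _ _ (HJu u) (HJu v)) hB -Jsc -linearDl.
have [_ inj surj] := hUpsilon.
have F0 u : F u = 0 -> u = 0.
  move=> Fu; apply: J0; apply: inj => [|_ /DE[v ->]]; first by apply/DE; exists u.
  by rewrite OF Fu linear0l.
have [[N0 Nd NZ ND] [[al al0 hal] Nc _ _]] := hsolv.1.
have JD u : D (J u) by apply/DE; exists u.
pose p u := complex.Re (N (J u)).
have NE u : N (J u) = real_complex R (p u) by rewrite [LHS]ge0_RRe ?N0.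
have al1 : 0 < complex.Re al by move: al0; rewrite ltcE => /andP[].
have alp u : sinorm (re_inner (ip := ip)) (J u) <= complex.Re al * p u.
  have := hal _ (JD u); rewrite (norm_re hip) NE lecE => /andP[_] /=.
  by rewrite mulrC Re_mulR mulrC.
(* This is |H x| <= c N x on D: p is N pulled back along [J], complete because D is, and <u, J a> =
   <J u, a> is p-bounded since N dominates the norm. *)
have [c c0 hc] : exists2 c : R, 0 <= c & forall u, sinorm (re_inner (ip := ip)) u <= c * p u.
  apply: (closed_graph_bounded hV (f := id) (Y := range J)) => //.
  - by move=> u; have := N0 _ (JD u); rewrite lecE => /andP[].
  - move=> u v; rewrite /p (linD Jl); have := ND _ _ (JD u) (JD v).
    by rewrite lecE => /andP[_]; rewrite (raddfD (@complex.Re R)).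
  - move=> a u; rewrite /p (linZ Jl) NZ// normr_real_complex Re_mulR //.
  - move=> u cu; have [||_ /DE[l ->] hl] := Nc (J \o u).
    + by move=> n; exact: JD.
    + move=> e e0; have e1 : 0 < complex.Re e by move: e0; rewrite ltcE => /andP[].
      have [n0 hn] := cu _ e1; exists n0 => m n hm hn'.
      by rewrite /= -(linB Jl) NE [e]ge0_RRe ?(ltW e0)// ltcR; exact: hn.
    + exists l; apply/tendsP => [u'|e e0].
        by have := N0 _ (JD u'); rewrite lecE => /andP[].
      have e1 : 0 < real_complex R e by rewrite ltcR.
      have [n0 hn] := hl _ e1; exists n0 => n /hn.
      by rewrite /= -(linB Jl) NE ltcR.
  - exact: (J_dense hV Jl Js J0).
  - move=> _ [a _ <-]; exists (complex.Re al * sinorm (re_inner (ip := ip)) a) => u.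
    rewrite -Js; apply: le_trans (si_le hg _ _) _; rewrite mulrAC.
    by rewrite ler_wpM2r ?sinorm_ge0.
(* H as a total function, with arbitrary values off D. *)
have [h hJ] : exists h : V -> V, forall u, h (J u) = u.
  have hch x : exists y, D x -> J y = x.
    by have [/DE[u ->]|nDx] := pselect (D x); [exists u|exists 0].
  have [h hP] := choice hch.
  by exists h => u; apply: (J_inj Jl J0); exact: hP.
(* The functional x -> <v, H x> is N-bounded by [hc]; the vector J u representing it satisfies <F u,
   w> = <v, w> for all w. *)
have Fo v : exists u, F u = v.
  have [|_ /DE[u ->] hu] := surj (fun x => ip v (h x)).
    split.
      move=> a _ _ /DE[x ->] /DE[y ->]; rewrite -Jl !hJ.
      by rewrite linearDr linearZr_LR.
    exists (real_complex R (2 * sinorm (re_inner (ip := ip)) v * c)); split.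
      by rewrite ler0c !mulr_ge0 ?sinorm_ge0.
    move=> _ /DE[u ->]; rewrite hJ NE -rmorphM/=.
    apply: le_trans (norm_ip_le hip _ _) _; rewrite lecR.
    by have := ler_wpM2l (sinorm_ge0 (g:=re_inner (ip := ip)) v) (hc u); lra.
  by exists u; apply: (ip_nondeg hip) => w; rewrite -OF -hu ?hJ.
have QBE x y : QB (x, y) <-> y = F x.
  rewrite hQB; split=> [[q [z [qx [b [a ax ba] bz] yz]]]|->].
    have {}qx : q = Q x := qx; have {}ba : b = B a := ba; have {}yz : y = q + z := yz.
    have /HE {}ax : H (a, x) := ax; have /HE {}bz : H (z, b) := bz.
    by rewrite yz qx bz ba ax.
  exists (Q x), (J (B (J x))); split => //.
  by exists (B (J x)); [exists (J x); [exact/HE|]|exact/HE].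
symmetry; rewrite -[form_operator _ _ _]hT TE.
have [Fi [FK FiK]] : exists Fi, cancel F Fi /\ cancel Fi F.
  have [Fi FiK] := choice Fo; exists Fi; split => // x.
  apply/eqP; rewrite -subr_eq0; apply/eqP; apply: F0.
  by rewrite (linB (F_lin Jl Ql Bl FE)) FiK subrr.
have Fl := F_lin Jl Ql Bl FE.
have Fb := F_bounded hV Jb Qb Bb FE.
have Fib := inverse_bounded hV Fl Fb FK FiK.
have DJ : D = range J.
  by apply/seteqP; split=> [x /DE[u ->]|_ [u _ <-]//]; exists u.
apply: (op_sqrt_abs_dom hip).
- exact: sandwich_lin.
- exact: (sandwich_closed hV Jl Jb Ql Bl Bb FE FK FiK Fib).
- exact: sandwich_op.
- exact: (sandwich_dom hV Jl Js J0 Ql Bl FE FK FiK Fib).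
move=> P S hP PT hS SP; rewrite DJ.
case: hyp => [QD|[Qp|[gamma hT']]].
- apply: (root_dom_stable hV Jl Jb Js J0 Ql Qb Bl Bb FE F0 Fo hP PT hS SP) => u.
    have : op_image QB D (F (J u)) by exists (J u) => //; exact/QBE.
    by rewrite QD => /DE.
  have : D (J u) by []; rewrite -QD => -[_ /DE[v ->] /QBE e]; by exists v.
- apply: (root_dom_semibounded hV Jl Jb Js J0 Ql Qb Bl Bb FE F0 Fo
    hP PT hS SP (gamma := 0)) => u _.
  have /ip_ge0[h1 h2] := Qp u (F u) (iffRL (QBE _ _) erefl).
  by rewrite mul0r.
- apply: (root_dom_semibounded hV Jl Jb Js J0 Ql Qb Bl Bb FE F0 Fo
    hP PT hS SP (gamma := gamma)) => u [y Ty].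
  have Fu := sandwichF Jl J0 FE Ty erefl.
  have h1 : op_add T (op_graph B) (J u, y + B (J u)).
    by exists y, (B (J u)); split => //; rewrite TE.
  (* <(T + B) J u, J u> = <F u, u>; the order on R[i] also makes it real. *)
  have := hT' _ _ h1; rewrite -Jsc -Fu (norm_re hip) -rmorphXn -rmorphM/=.
  rewrite (sinormE hg) lecE /= => /andP[/eqP Im0 ?].
  by rewrite Im_ip Im0 oppr0.
Qed.
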